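(* Among second order differential equations $u''=f(x,u,u')$ with $f\in\mathcal{Q}[u']$, the equations of the form $$u''=D(x,u)\,(u'-w_1(x,u))(u'-w_2(x,u))(u'-w_3(x,u))=:A(x,u)+B(x,u)u'+C(x,u)u'^2+D(x,u)u'^3,$$ with $A,B,C,D\in\mathcal{Q}$ and $w_1,w_2,w_3\in\mathcal{O}$, are exactly those for which the set of integral curves in the plane $(\mathbb{C}^2,0)$ possesses, at each non-singular point of the coefficients of the equation (which belong to $\mathcal{Q}$), a pencil of second order contact conics.
   Context: $\mathcal{O}=\mathbb{C}\{x,u\}$ is the ring of germs of holomorphic functions at $0\in\mathbb{C}^2$ and $\mathcal{Q}=\mathrm{Frac}(\mathcal{O})$ its field of fractions; $u'=\frac{du}{dx}$, $u''=\frac{d^2u}{dx^2}$. A point is non-singular for the coefficients if it is not a singular point (pole) of any of them. A pencil of conics is a one-parameter linear family of plane conics $\lambda\,\mathfrak{g}_1(x,u)+\mu\,\mathfrak{g}_2(x,u)=0$, $[\lambda:\mu]\in\mathbb{C}P_1$, with $\mathfrak{g}_1,\mathfrak{g}_2$ polynomials of degree at most two with constant complex coefficients. Definition. Let $u''=f(x,u,u')$ with $f\in\mathcal{Q}[u']$. The set of its integral curves in $(\mathbb{C}^2,0)$ possesses a pencil of second order contact conics at a non-singular point $P=(x_P,u_P)\in(\mathbb{C}^2,0)$ of its coefficients if and only if there exists a germ of pencil of conics which passes through $P$ and such that every germ of integral curve of $u''=f(x,u,u')$ which passes through $P$ has a contact of second order at $P$ with a conic of the pencil. This means: if the germ of integral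 curve is parameterized by $(x,u(x),u'(x))$ with $u(x)$ a convergent power series, then there is a conic $\mathfrak{g}(x,u)=0$ of the pencil such that $$\mathfrak{g}(x,u(x))=\big(\mathfrak{g}(x,u(x))\big)'=\big(\mathfrak{g}(x,u(x))\big)''=0\quad\text{at }P\ (x=x_P),\qquad {}'=\tfrac{d}{dx}.$$
   Formalization: The contact conic must be smooth at P (else every equation qualifies); the equivalence is for all A+Bu'+Cu'^2+Du'^3 (u''=1 has pencils but does not factor); factored implies pencils, and the converse is given when D≠0, f/D has coefficients in O and its slopes at 0 are distinct. *)

(* Defs.v *)
From HB Require Import structures.
From mathcomp Require Import all_boot all_order all_algebra.
From mathcomp Require Import fraction separable.
From mathcomp Require Import all_classical all_reals all_analysis.
From mathcomp Require Import complex.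
From mathcomp Require Import ring zify.

Set Implicit Arguments.
Unset Strict Implicit.
Unset Printing Implicit Defensive.

Import Order.TTheory GRing.Theory Num.Theory.
Import numFieldNormedType.Exports.

Local Open Scope classical_set_scope.
Local Open Scope ring_scope.

HB.instance Definition _ (R : realType) := NormedModule.copy R[i] R[i]^o.

Record fps (K : Type) := Fps { fcoef : nat -> K }.

HB.instance Definition _ (K : Type) := gen_eqMixin (fps K).
HB.instance Definition _ (K : Type) := gen_choiceMixin (fps K).

Lemma fpsP (K : Type) (a b : fps K) : (forall n, fcoef a n = fcoef b n) <-> a = b.
Proof.
split=> [|->//]; case: a b => [a] [b] /= ab; congr Fps.
exact/funext.
Qed.

Section FpsRing.
Variable K : comNzRingType.
Implicit Types a b c : fps K.

Definition fps_zero : fps K := Fps (fun=> 0).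
Definition fps_one : fps K := Fps (fun n => (n == 0)%:R).
Definition fps_opp a : fps K := Fps (fun n => - fcoef a n).
Definition fps_add a b : fps K := Fps (fun n => fcoef a n + fcoef b n).
Definition fps_mul a b : fps K :=
  Fps (fun n => \sum_(k < n.+1) fcoef a k * fcoef b (n - k)%N).

Lemma fps_addA : associative fps_add.
Proof. by move=> a b c; apply/fpsP => n /=; rewrite addrA. Qed.
Lemma fps_addC : commutative fps_add.
Proof. by move=> a b; apply/fpsP => n /=; rewrite addrC. Qed.
Lemma fps_add0 : left_id fps_zero fps_add.
Proof. by move=> a; apply/fpsP => n /=; rewrite add0r. Qed.
Lemma fps_addN : left_inverse fps_zero fps_opp fps_add.
Proof. by move=> a; apply/fpsP => n /=; rewrite addNr. Qed.

HB.instance Definition _ :=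
  GRing.isZmodule.Build (fps K) fps_addA fps_addC fps_add0 fps_addN.

Let tr n a : {poly K} := \poly_(i < n) fcoef a i.

Let eqp n (p q : {poly K}) := forall i, (i < n)%N -> p`_i = q`_i.

Let eqpM n p p' q q' : eqp n p p' -> eqp n q q' -> eqp n (p * q) (p' * q').
Proof.
move=> pp' qq' i lin; rewrite !coefM; apply: eq_bigr => k _.
rewrite pp' ?qq' //; first exact: leq_ltn_trans (leq_subr _ _) lin.
exact: leq_ltn_trans (leq_ord k) lin.
Qed.

Let tr_mul n a b : eqp n (tr n (fps_mul a b)) (tr n a * tr n b).
Proof.
move=> i lin; rewrite coefM coef_poly lin /=; apply: eq_bigr => k _.
rewrite !coef_poly (leq_ltn_trans (leq_ord k) lin).
by rewrite (leq_ltn_trans (leq_subr _ _) lin).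
Qed.

Let tr_inj a b : (forall n, eqp n (tr n a) (tr n b)) -> a = b.
Proof. by move=> ab; apply/fpsP => n; have := ab n.+1 n (ltnSn n); rewrite !coef_poly ltnSn. Qed.

Lemma fps_mulA : associative fps_mul.
Proof.
move=> a b c; apply: tr_inj => n i lin.
rewrite (tr_mul a _ lin) (tr_mul _ c lin).
transitivity ((tr n a * (tr n b * tr n c))`_i).
  by apply: (@eqpM n) => //; exact: tr_mul.
by rewrite mulrA; apply/esym/(@eqpM n) => //; exact: tr_mul.
Qed.

Lemma fps_mulC : commutative fps_mul.
Proof.
move=> a b; apply: tr_inj => n i lin.
by rewrite (tr_mul a _ lin) (tr_mul _ a lin) mulrC.
Qed.

Lemma fps_mul1 : left_id fps_one fps_mul.
Proof.
move=> a; apply/fpsP => n /=; rewrite big_ord_recl /= mul1r subn0.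
by rewrite big1 ?addr0 // => k _; rewrite mul0r.
Qed.

Lemma fps_mulDl : left_distributive fps_mul fps_add.
Proof.
move=> a b c; apply/fpsP => n /=.
by rewrite -big_split; apply: eq_bigr => k _; rewrite mulrDl.
Qed.

Lemma fps_one_neq0 : fps_one != 0.
Proof. by apply/eqP => /fpsP /(_ 0)/= /eqP; rewrite oner_eq0. Qed.

HB.instance Definition _ := GRing.Zmodule_isComNzRing.Build (fps K)
  fps_mulA fps_mulC fps_mul1 fps_mulDl fps_one_neq0.

Lemma fcoef0 n : fcoef (0 : fps K) n = 0. Proof. by []. Qed.
Lemma fcoef1 n : fcoef (1 : fps K) n = (n == 0)%:R. Proof. by []. Qed.
Lemma fcoefN a n : fcoef (- a) n = - fcoef a n. Proof. by []. Qed.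
Lemma fcoefD a b n : fcoef (a + b) n = fcoef a n + fcoef b n. Proof. by []. Qed.
Lemma fcoefM a b n :
  fcoef (a * b) n = \sum_(k < n.+1) fcoef a k * fcoef b (n - k)%N.
Proof. by []. Qed.

Lemma fcoef_sum (I : Type) (r : seq I) (P : pred I) (F : I -> fps K) n :
  fcoef (\sum_(i <- r | P i) F i) n = \sum_(i <- r | P i) fcoef (F i) n.
Proof.
elim/big_rec2: _ => [|i y x _ <-]; first exact: fcoef0.
exact: fcoefD.
Qed.

Lemma fps_neq0P a : a != 0 ->
  exists m, fcoef a m != 0 /\ forall k, (k < m)%N -> fcoef a k = 0.
Proof.
move=> a0; have ex : exists m, fcoef a m != 0.
  apply: contrapT => /forallNP h; move/eqP: a0; apply.
  by apply/fpsP => n; apply/eqP; move: (h n) => /negP; rewrite negbK.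
exists (ex_minn ex); case: ex_minnP => m am min; split=> // k km.
by apply/eqP; apply: contraLR km => /min; rewrite -leqNgt.
Qed.

Lemma fps_integral :
  GRing.integral_domain_axiom K -> GRing.integral_domain_axiom (fps K).
Proof.
move=> intK a b ab0; case: eqVneq => //= /fps_neq0P[m [am mina]].
case: eqVneq => //= /fps_neq0P[n [bn minb]].
have : fcoef (a * b) (m + n) = 0 by rewrite ab0.
rewrite fcoefM (bigD1 (inord m)) //= inordK ?ltnS ?leq_addr// addKn.
rewrite big1 ?addr0 => [|k km].
  by move/intK => /orP[] h; [case/negP: am|case/negP: bn].
have {}km : nat_of_ord k != m.
  by apply: contra km => /eqP km; apply/eqP/val_inj; rewrite /= inordK ?km // ltnS leq_addr.
have [lt|ge] := ltnP k m; first by rewrite mina ?mul0r.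
rewrite minb ?mulr0 //; have := ltn_ord k; lia.
Qed.

End FpsRing.

Section Germs.
Variable R : realType.
Local Notation C := R[i].

(* Coefficient of x^i u^j: the outer series is in x, the inner ones in u. *)
Definition coef2 (a : fps (fps C)) (i j : nat) : C := fcoef (fcoef a i) j.

Definition bounded_on (a : nat -> nat -> C) (r s : C) : Prop :=
  exists M : C, forall i j, `|a i j| * r ^+ i * s ^+ j <= M.

(* By Abel's lemma, convergence of [a] on some neighbourhood of 0. *)
Definition convergent2 : {pred fps (fps C)} :=
  fun a => `[< exists r : C, 0 < r /\ bounded_on (coef2 a) r r >].

Lemma coef2M a b i j : coef2 (a * b) i j =
  \sum_(k < i.+1) \sum_(l < j.+1) coef2 a k l * coef2 b (i - k)%N (j - l)%N.
Proof. by rewrite /coef2 fcoefM fcoef_sum; apply: eq_bigr. Qed.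

Lemma bounded_on_le (a : nat -> nat -> C) (r s : C) :
  0 <= s -> s <= r -> bounded_on a r r -> bounded_on a s s.
Proof.
move=> s0 sr [M aM]; exists M => i j; apply: le_trans (aM i j).
have r0 := le_trans s0 sr.
by rewrite -!mulrA ler_wpM2l ?normr_ge0 // ler_pM ?exprn_ge0 // lerXn2r ?nnegrE.
Qed.

Lemma min_radius (r s : C) : 0 < r -> 0 < s ->
  exists t : C, [/\ 0 < t, t <= r & t <= s].
Proof.
move=> r0 s0; have := real_leVge (gtr0_real r0) (gtr0_real s0).
by case/orP => h; [exists r|exists s].
Qed.

Lemma convergent2_subring : subring_closed convergent2.
Proof.
split.
- apply/asboolP; exists 1; split=> //; exists 1 => i j.
  rewrite !expr1n !mulr1 /coef2 fcoef1.
  case: eqP => _; last by rewrite mulr0n fcoef0 normr0 ler01.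
  by rewrite mulr1n fcoef1; case: eqP; rewrite ?normr1 ?normr0 ?ler01.
- move=> a b /asboolP[r [r0 ar]] /asboolP[s [s0 bs]]; apply/asboolP.
  have [t [t0 tr ts]] := min_radius r0 s0; exists t; split=> //.
  have [M aM] := bounded_on_le (ltW t0) tr ar.
  have [N bN] := bounded_on_le (ltW t0) ts bs.
  exists (M + N) => i j; apply: le_trans (lerD (aM i j) (bN i j)).
  have tn n : 0 <= t ^+ n by rewrite exprn_ge0 // ltW.
  rewrite -!mulrDl -!mulrA; apply: ler_wpM2r; first exact: mulr_ge0.
  by rewrite /coef2 !(fcoefD, fcoefN) ler_normB.
- move=> a b /asboolP[r [r0 ar]] /asboolP[s [s0 bs]]; apply/asboolP.
  have [t [t0 tr ts]] := min_radius r0 s0.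
  have [M aM] := bounded_on_le (ltW t0) tr ar.
  have [N bN] := bounded_on_le (ltW t0) ts bs.
  have M0 : 0 <= M.
    by apply: le_trans (aM 0 0); rewrite !expr0 !mulr1 normr_ge0.
  exists (t / 2%:R); split; first by rewrite divr_gt0.
  exists (M * N) => i j; rewrite coef2M.
  have N0 : 0 <= N.
    by apply: le_trans (bN 0 0); rewrite !expr0 !mulr1 normr_ge0.
  have termP (k : 'I_i.+1) (l : 'I_j.+1) :
      `|coef2 a k l * coef2 b (i - k)%N (j - l)%N| * (t ^+ i * t ^+ j) <= M * N.
    have ki : (k <= i)%N by rewrite -ltnS.
    have lj : (l <= j)%N by rewrite -ltnS.
    have -> : t ^+ i = t ^+ k * t ^+ (i - k) by rewrite -exprD subnKC.
    have -> : t ^+ j = t ^+ l * t ^+ (j - l) by rewrite -exprD subnKC.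
    rewrite normrM.
    rewrite (_ : _ * _ = (`|coef2 a k l| * t ^+ k * t ^+ l)
      * (`|coef2 b (i - k)%N (j - l)%N| * t ^+ (i - k) * t ^+ (j - l)));
      last by ring.
    by apply: ler_pM; rewrite ?mulr_ge0 ?normr_ge0 ?exprn_ge0 ?(ltW t0).
  have t0n n : 0 <= t ^+ n by rewrite exprn_ge0 // ltW.
  have sumP : `|\sum_(k < i.+1) \sum_(l < j.+1)
        coef2 a k l * coef2 b (i - k)%N (j - l)%N| * (t ^+ i * t ^+ j)
      <= i.+1%:R * j.+1%:R * (M * N).
    apply: le_trans (_ : (\sum_(k < i.+1) \sum_(l < j.+1) M * N) <= _); last first.
      by rewrite !sumr_const !card_ord -mulrnA mulnC -[in X in X <= _]mulr_natl natrM.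
    apply: le_trans (ler_wpM2r (mulr_ge0 (t0n i) (t0n j)) (ler_norm_sum _ _ _)) _.
    rewrite mulr_suml ler_sum // => k _.
    apply: le_trans (ler_wpM2r (mulr_ge0 (t0n i) (t0n j)) (ler_norm_sum _ _ _)) _.
    by rewrite mulr_suml ler_sum // => l _; exact: termP.
  have halfP n : n.+1%:R / 2%:R ^+ n <= 1 :> C.
    by rewrite ler_pdivrMr ?exprn_gt0 // mul1r -natrX ler_nat ltn_expl.
  have h0 n : 0 <= (2%:R : C) ^- n by rewrite invr_ge0 exprn_ge0.
  rewrite !expr_div_n -[leRHS]mul1r -[X in X * (M * N)]mul1r.
  apply: le_trans (_ : (i.+1%:R / 2%:R ^+ i) * (j.+1%:R / 2%:R ^+ j) * (M * N) <= _).
    rewrite [leRHS](_ : _ = i.+1%:R * j.+1%:R * (M * N)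
      * (2%:R ^- i * 2%:R ^- j)); last by ring.
    apply: le_trans (ler_wpM2r (mulr_ge0 (h0 i) (h0 j)) sumP).
    by rewrite le_eqVlt; apply/orP; left; apply/eqP; ring.
  apply: ler_wpM2r; first exact: mulr_ge0.
  by rewrite ler_pM ?mulr_ge0 ?ler0n.
Qed.

HB.instance Definition _ :=
  GRing.isSubringClosed.Build (fps (fps C)) convergent2 convergent2_subring.

(* C{x,u}, a germ being given by its Taylor series at 0. *)
Record germ := Germ { germ_val :> fps (fps C); _ : germ_val \in convergent2 }.

HB.instance Definition _ := [isSub for germ_val].
HB.instance Definition _ := [Choice of germ by <:].
HB.instance Definition _ := [SubChoice_isSubComNzRing of germ by <:].

Definition germ_unit : {pred germ} := fun a => `[< exists b, b * a = 1 >].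
Definition germ_inv (a : germ) : germ :=
  match pselect (exists b, b * a = 1) with
  | left e => projT1 (cid e)
  | right _ => a
  end.

Lemma germ_mulV : {in germ_unit, left_inverse 1 germ_inv *%R}.
Proof.
move=> a /asboolP e; rewrite /germ_inv; case: pselect => // e'.
by case: cid.
Qed.
Lemma germ_unitP (a b : germ) : b * a = 1 -> germ_unit a.
Proof. by move=> ba; apply/asboolP; exists b. Qed.
Lemma germ_inv_out : {in [predC germ_unit], germ_inv =1 id}.
Proof.
by move=> a /asboolP ne; rewrite /germ_inv; case: pselect.
Qed.

HB.instance Definition _ := GRing.ComNzRing_hasMulInverse.Build germ
  germ_mulV germ_unitP germ_inv_out.

Lemma germ_integral : GRing.integral_domain_axiom germ.
Proof.
move=> a b ab0.
have C_int : GRing.integral_domain_axiom C.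
  by move=> x y /eqP; rewrite mulf_eq0.
have := fps_integral (fps_integral C_int).
by move=> /(_ (val a) (val b)); apply; rewrite -rmorphM ab0 rmorph0.
Qed.

HB.instance Definition _ := GRing.ComUnitRing_isIntegral.Build germ germ_integral.

End Germs.

Notation meromorphic R := {fraction (germ R)}.

Section Equations.
Variable R : realType.
Local Notation C := R[i].
Implicit Types (a b : germ R) (q : meromorphic R) (P : C * C) (f : {poly (meromorphic R)}).

(* [P] lies inside an open polydisc centred at 0 on which the Taylor series *)
(* of [a] at 0 converges.                                                   *)
Definition in_polydisc a P : Prop :=
  exists r s : C, [/\ `|P.1| < r, `|P.2| < s & bounded_on (coef2 a) r s].

Definition germ_eval a P : C :=
  limn (series (fun i =>
    limn (series (fun j => coef2 a i j * P.2 ^+ j)) * P.1 ^+ i)).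

(* The value does not depend on the fraction chosen: if a / b = c / d and   *)
(* all four converge at [P], then a * d = b * c holds at [P].               *)
Definition frac_value q P (v : C) : Prop :=
  exists a b, [/\ q = FracField.tofrac a / FracField.tofrac b,
    in_polydisc a P /\ in_polydisc b P, germ_eval b P != 0
    & v = germ_eval a P / germ_eval b P].

(* For [P] close enough to 0 this says that the reduced denominator of [q]  *)
(* does not vanish at [P], since germs coprime at 0 stay coprime at nearby  *)
(* points.  Points of indeterminacy, as 0 for x / u, are singular.          *)
Definition nonsingular q P : Prop := exists v, frac_value q P v.

(* 0 if [P] is singular for [q]. *)
Definition frac_eval q P : C := xget 0 [set v | frac_value q P v].

Definition nonsingular_coefs f P : Prop := forall k, nonsingular f`_k P.

Definition rhs f P (p : C) : C := \sum_(k < size f) frac_eval f`_k P * p ^+ k.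

Definition analytic_at (u : C -> C) (x0 : C) : Prop :=
  exists c : nat -> C, \forall x \near x0,
    series (fun n => c n * (x - x0) ^+ n) @ \oo --> u x.

Definition integral_curve f P (u : C -> C) : Prop :=
  [/\ analytic_at u P.1, u P.1 = P.2
    & \forall x \near P.1, derive1n 2 u x = rhs f (x, u x) (derive1 u x)].

(* In [{poly {poly C}}] the outer variable is u and the inner one is x. *)
Implicit Types g : {poly {poly C}}.

Definition degree_le2 g : Prop := forall i j, (2 < i + j)%N -> g`_i`_j = 0.

Definition eval_xu g P : C := g.[P.2%:P].[P.1].

Definition smooth_at g P : Prop :=
  (deriv g.[P.2%:P]).[P.1] != 0 \/ eval_xu (deriv g) P != 0.

Definition contact2 g P (u : C -> C) : Prop :=
  let h x := eval_xu g (x, u x) in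
  [/\ h P.1 = 0, derive1 h P.1 = 0 & derive1n 2 h P.1 = 0].

Definition member g1 g2 (l m : C) : {poly {poly C}} := l%:P *: g1 + m%:P *: g2.

Definition is_pencil g1 g2 : Prop :=
  [/\ degree_le2 g1, degree_le2 g2
    & forall l m, member g1 g2 l m = 0 -> l = 0 /\ m = 0].

(* Contact of order two is contact of two smooth germs of curves, so the    *)
(* conic has to be smooth at [P].  Without this the pencil of line pairs    *)
(*   (x - xP) (l (x - xP) + m (u - uP)) = 0                                 *)
(* would satisfy the three equations of [contact2] for every curve through  *)
(* [P], hence for every equation.                                           *)
Definition contact_pencil f P : Prop :=
  exists g1 g2, [/\ is_pencil g1 g2, eval_xu g1 P = 0, eval_xu g2 P = 0
    & forall u, integral_curve f P u -> exists l m,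
        [/\ (l, m) != (0, 0), smooth_at (member g1 g2 l m) P
          & contact2 (member g1 g2 l m) P u]].

Definition has_contact_pencils f : Prop :=
  \forall P \near ((0, 0) : C * C), nonsingular_coefs f P -> contact_pencil f P.

Definition cubic_form f : Prop :=
  exists A B C D : meromorphic R, f = A%:P + B *: 'X + C *: 'X^2 + D *: 'X^3.

Definition factored_form f : Prop :=
  exists (D : meromorphic R) (w1 w2 w3 : germ R),
    f = D *: (('X - (FracField.tofrac w1)%:P) * ('X - (FracField.tofrac w2)%:P)
              * ('X - (FracField.tofrac w3)%:P)).

(* Up to its coefficient of degree three, [f] is monic over C{x,u} and its  *)
(* reduction at the origin, a polynomial over C, has only simple roots.     *)
(* Some such condition is needed to factor a cubic form over C{x,u}: the    *)
(* equation u'' = 1 has a cubic form, but not a factored one.               *)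
Definition simple_slopes f : Prop :=
  f`_3 != 0 /\ exists F : {poly (germ R)},
    [/\ F \is monic, f = f`_3 *: map_poly (@FracField.tofrac (germ R)) F
      & separable_poly (map_poly (fun a => coef2 a 0 0) F)].

End Equations.

(* Main.v *)
Require Import Defs.
From HB Require Import structures.
From mathcomp Require Import all_boot all_order all_algebra.
From mathcomp Require Import fraction separable generic_quotient.
From mathcomp Require Import all_classical all_reals all_analysis.
From mathcomp Require Import complex.
From mathcomp Require Import ring lra zify.

Set Implicit Arguments.
Unset Strict Implicit.
Unset Printing Implicit Defensive.

Import Order.TTheory GRing.Theory Num.Theory.
Import numFieldNormedType.Exports.

Local Open Scope classical_set_scope.
Local Open Scope ring_scope.

(* At a nonsingular point P, contact of order two with a smooth conic of a
   pencil through P only involves the slope p = u' and y = u'' at P.  When the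
   linear parts of the two generators of the pencil are independent, the conic
   with slope p is unique up to a scalar and the last equation of contact makes
   y a cubic polynomial in p, and every cubic polynomial arises in this way.  When
   they are dependent, all conics of the pencil that are smooth at P are tangent.

   For the converse one needs an integral curve of every slope at a generic
   point P.  Near such a point f = (sum_j a_j u'^j) / b with germs a_j, b and
   b(P) <> 0, and V = u'' is a fixed point of
     V |-> b(P)^-1 (sum_j a_j(x, U) U'^j - V (b(x, U) - b(P))),
   where U' and U are the iterated primitives of V.  This map contracts the
   filtration of formal power series by the order, so it has a formal fixed
   point, and for a small radius it preserves a ball of the weighted l^1 norm,
   so the fixed point converges.  The same argument in two variables lifts the
   simple roots of the reduced cubic to roots w_i in C{x,u}. *)

(** * Series of complex numbers *)

(** No completed function space is formed. A norm is replaced by its truncations to finitely many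
    coefficients, with a bound uniform in the truncation. Each truncation is already
    submultiplicative, and such a bound survives coefficientwise limits, so one iteration yields
    both the formal solution and its convergence. Division by b is avoided by freezing b(P). In the
    remaining term V (b(x, U) - b(P)) the second factor has no constant term along the curve: this
    gains the order needed formally, and makes the factor small on a small disc. Taylor series of
    germs stay centred at 0 although the curves start elsewhere, so the room tau between P and the
    boundary of the polydisc enters the Lipschitz estimates. All slopes at one point are needed in
    the converse, because only then do the contact conditions become an identity of polynomials in
    p. The point has to avoid the zeros of the leading coefficient of f, where the degree in u'
    drops. *)

Section ComplexSums.
Variable R : realType.
Local Notation C := R[i].
Local Notation nc := (@Normc.normc R).
Implicit Types (z : C) (f g : nat -> C).

(** The norm of [R[i]] takes its values in [R[i]], whose order is partial. [nc] is the same modulus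
    read in [R], where suprema exist and linear arithmetic applies. *)
Lemma nc_norm z : `|z| = (nc z)%:C%C.
Proof. by rewrite normc_def; case: z. Qed.
Lemma ncM z w : nc (z * w) = nc z * nc w.
Proof. exact: Normc.normcM. Qed.
Lemma ncN z : nc (- z) = nc z.
Proof. exact: normcN. Qed.
Lemma ncD z w : nc (z + w) <= nc z + nc w.
Proof. exact: le_normcD. Qed.
Lemma nc_ge0 z : 0 <= nc z.
Proof. by rewrite -ler0c -nc_norm normr_ge0. Qed.
Lemma nc0 : nc 0 = 0. Proof. exact: Normc.normc0. Qed.
Lemma nc1 : nc 1 = 1. Proof. exact: Normc.normc1. Qed.
Lemma ncV z : nc z^-1 = (nc z)^-1. Proof. exact: Normc.normcV. Qed.
Lemma ncX z n : nc (z ^+ n) = nc z ^+ n.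
Proof. by elim: n => [|n IH]; rewrite ?expr0 ?nc1 // !exprS ncM IH. Qed.
Lemma ncC z w : nc (z - w) = nc (w - z).
Proof. by rewrite -ncN opprB. Qed.
Lemma nc_gt0 z : (0 < nc z) = (z != 0).
Proof. by rewrite -ltcR -nc_norm normr_gt0. Qed.
Lemma nc_real (x : R) : 0 <= x -> nc x%:C%C = x.
Proof. by move=> x0; rewrite /nc /= expr0n addr0 sqrtr_sqr ger0_norm. Qed.
Lemma nc_nat n : nc n%:R = n%:R.
Proof. by rewrite -(rmorph_nat (real_complex R)) nc_real ?ler0n. Qed.
Lemma nc_sum I (r : seq I) (P : pred I) (F : I -> C) :
  nc (\sum_(i <- r | P i) F i) <= \sum_(i <- r | P i) nc (F i).
Proof.
elim/big_rec2: _ => [|i y x _ h]; first by rewrite nc0.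
by apply: le_trans (ncD _ _) _; rewrite lerD2l.
Qed.
(** A complex number above a norm is real, so the radii occurring in [in_polydisc] can be replaced
    by their real parts. *)
Lemma nc_lt z (r : C) : (`|z| < r) = (r == (complex.Re r)%:C%C) && (nc z < complex.Re r).
Proof.
case: r => a b; rewrite nc_norm ltcE /= eq_complex /= eqxx /=.
by rewrite andbC.
Qed.
Lemma nc_Re z : `|complex.Re z| <= nc z.
Proof. by rewrite -lecR -nc_norm normc_ge_Re. Qed.
Lemma nc_Im z : `|complex.Im z| <= nc z.
Proof.
case: z => a b /=; rewrite -sqrtr_sqr ler_wsqrtr //; have := sqr_ge0 a; lra.
Qed.
Lemma nc_ReIm z : nc z <= `|complex.Re z| + `|complex.Im z|.
Proof.
case: z => a b /=; rewrite -(ger0_norm (addr_ge0 (normr_ge0 a) (normr_ge0 b))).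
rewrite -[leRHS]sqrtr_sqr ler_wsqrtr // sqrrD !real_normK ?num_real //.
have := mulr_ge0 (normr_ge0 a) (normr_ge0 b); lra.
Qed.

Lemma ccvgP {T} {F : set_system T} {FF : Filter F} (f : T -> C) (l : C) :
  f @ F --> l <-> forall e : R, 0 < e -> \forall t \near F, nc (f t - l) < e.
Proof.
split=> [/cvgrPdist_lt h e e0|h].
  have e0' : 0 < (e%:C)%C by rewrite ltcR.
  by apply: filterS (h _ e0') => t; rewrite nc_norm ltcR ncC.
apply/cvgrPdist_lt => e e0.
have ee : e = (complex.Re e)%:C%C by rewrite RRe_real // gtr0_real.
have : 0 < complex.Re e by rewrite -ltcR -ee.
move=> /h; apply: filterS => t; rewrite ee nc_norm ltcR ncC //.
Qed.

Lemma near_ncP (P : C -> Prop) (x : C) :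
  (\forall y \near x, P y) <->
  exists2 e : R, 0 < e & forall y, nc (y - x) < e -> P y.
Proof.
split=> [/nbhs_normP[e /= e0 h]|[e e0 h]].
  have ee : e = (complex.Re e)%:C%C by rewrite RRe_real // gtr0_real.
  exists (complex.Re e); first by rewrite -ltcR -ee.
  by move=> y yx; apply: h => /=; rewrite distrC ee nc_norm ltcR.
apply/nbhs_normP; exists (e%:C)%C => /=; first by rewrite ltcR.
by move=> y /= yx; apply: h; rewrite ncC -ltcR -nc_norm.
Qed.

Lemma near_nc2P (P : C * C -> Prop) :
  (\forall y \near ((0, 0) : C * C), P y) <->
  exists2 e : R, 0 < e & forall x u, nc x < e -> nc u < e -> P (x, u).
Proof.
split=> [[[A B] /= [/near_ncP[a a0 hA] /near_ncP[b b0 hB]] h]|[e e0 h]].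
  exists (Num.min a b); first by rewrite lt_min a0.
  move=> x u; rewrite !lt_min => /andP[xa _] /andP[_ ub]; apply: h; split=> /=.
    by apply: hA; rewrite subr0.
  by apply: hB; rewrite subr0.
exists ([set x | nc x < e], [set x | nc x < e]); last first.
  by case=> x u [] /=; exact: h.
by split; apply/near_ncP; exists e => // y; rewrite subr0.
Qed.

Lemma nc_cvg_le {T} {F : set_system T} {FF : ProperFilter F} (f : T -> C) (l : C) (M : R) :
  f @ F --> l -> (\forall t \near F, nc (f t) <= M) -> nc l <= M.
Proof.
move=> /ccvgP fl fM; apply/ler_addgt0Pr => e e0.
have {}fl := fl _ e0; near F => t.
have tM : nc (f t) <= M by near: t.
have te : nc (f t - l) < e by near: t.
rewrite -[l](subrK (f t)); apply: le_trans (ncD _ _) _.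
by rewrite ncC addrC; apply: lerD => //; exact: ltW.
Unshelve. all: by end_near.
Qed.

(** Absolute summability as a bound on all partial sums: bounds then combine through finite sums
    only. *)
Definition asum (M : R) (f : nat -> C) : Prop :=
  forall n, \sum_(k < n) nc (f k) <= M.

Definition csum (f : nat -> C) : C := limn (series f).

Lemma asum_ge0 M f : asum M f -> 0 <= M.
Proof. by move=> /(_ 0%N); rewrite big_ord0. Qed.

Lemma eq_csum f g : f =1 g -> csum f = csum g.
Proof. by move=> /funext ->. Qed.

Lemma bounded_series_cvg (a : nat -> R) (M : R) :
  (forall n, \sum_(k < n) `|a k| <= M) -> cvgn (series a).
Proof.
move=> h; apply: normed_cvg; apply: nondecreasing_is_cvgn.
  apply: nondecreasing_series => n _ _; exact: normr_ge0.
by exists M => _ [n _ <-]; rewrite /= seriesEord; exact: h.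
Qed.

(** Convergence is inherited from [R]: the real and imaginary parts are dominated by the moduli, and
    their limits assemble into the limit. *)
Lemma csum_cvg M f : asum M f -> series f @ \oo --> csum f.
Proof.
move=> fM.
have hR : cvgn (series (fun k => complex.Re (f k))).
  by apply: (@bounded_series_cvg _ M) => n; apply: le_trans (fM n); apply: ler_sum => k _; exact: nc_Re.
have hI : cvgn (series (fun k => complex.Im (f k))).
  by apply: (@bounded_series_cvg _ M) => n; apply: le_trans (fM n); apply: ler_sum => k _; exact: nc_Im.
set a := limn _ in hR; set b := limn _ in hI.
apply: (cvgP (Complex a b)); apply/ccvgP => e e0.
have e2 : 0 < e / 2 by rewrite divr_gt0.
move/cvgrPdist_lt : hR => /(_ _ e2) hR; move/cvgrPdist_lt : hI => /(_ _ e2) hI.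
apply: filterS2 hR hI => n hR hI.
have -> : series f n = Complex (series (fun k => complex.Re (f k)) n) (series (fun k => complex.Im (f k)) n).
  rewrite /series /=; elim: n {hR hI} => [|n IH]; first by rewrite !big_nil.
  by rewrite !big_nat_recr //= IH; case: (f n).
apply: le_lt_trans (nc_ReIm _) _ => /=; rewrite ![`|series _ _ - _|]distrC.
by rewrite [e]splitr ltrD.
Qed.

Lemma csum_unique f (l : C) : series f @ \oo --> l -> csum f = l.
Proof. exact: cvg_lim. Qed.

Lemma csum_le M f : asum M f -> nc (csum f) <= M.
Proof.
move=> fM; apply: (nc_cvg_le (csum_cvg fM)); apply: nearW => n.
by apply: le_trans (fM n); rewrite /series /= big_mkord nc_sum.
Qed.

Lemma csum_fin n f : (forall k, (n <= k)%N -> f k = 0) -> csum f = \sum_(k < n) f k.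
Proof.
move=> h; apply: csum_unique; apply/ccvgP => e e0; exists n => // m /= nm.
rewrite /series /= (big_cat_nat (n := n)) //= big_mkord [X in _ + X - _]big1_seq ?addr0 ?subrr ?nc0 //.
by move=> i /andP[_]; rewrite mem_index_iota => /andP[ni _]; exact: h.
Qed.

Lemma asumD M N f g : asum M f -> asum N g -> asum (M + N) (fun k => f k + g k).
Proof.
move=> fM gN n; apply: le_trans (lerD (fM n) (gN n)).
by rewrite -big_split; apply: ler_sum => k _; exact: ncD.
Qed.

Lemma asumZ M c f : asum M f -> asum (nc c * M) (fun k => c * f k).
Proof.
move=> fM n; apply: le_trans (ler_wpM2l (nc_ge0 c) (fM n)).
by rewrite mulr_sumr; apply: ler_sum => k _; rewrite ncM.
Qed.

Lemma csumD M N f g : asum M f -> asum N g ->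
  csum (fun k => f k + g k) = csum f + csum g.
Proof.
move=> fM gN; apply: csum_unique.
rewrite (_ : series _ = series f \+ series g); last first.
  by apply/funext => n; rewrite /series /= big_split.
exact: cvgD (csum_cvg fM) (csum_cvg gN).
Qed.

Lemma csumZ M c f : asum M f -> csum (fun k => c * f k) = c * csum f.
Proof.
move=> fM; apply: csum_unique.
rewrite (_ : series _ = fun n => c * series f n); last first.
  by apply/funext => n; rewrite /series /= mulr_sumr.
apply: cvgM (csum_cvg fM); exact: cvg_cst.
Qed.

Lemma asum_shift M f m : asum M f -> asum M (fun k => f (m + k)%N).
Proof.
move=> fM n; apply: le_trans (fM (m + n)%N).
rewrite big_split_ord /= lerDr; apply: sumr_ge0 => i _; exact: nc_ge0.
Qed.

Lemma csum_split M f m : asum M f ->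
  csum f = \sum_(k < m) f k + csum (fun k => f (m + k)%N).
Proof.
move=> fM; apply: csum_unique; rewrite -(cvg_shiftn m).
rewrite (_ : (fun n => _) = (fun n => \sum_(k < m) f k + series (fun k => f (m + k)%N) n)).
  by apply: cvgD; [exact: cvg_cst|exact: csum_cvg (asum_shift m fM)].
apply/funext => n; rewrite /series /= !big_mkord addnC big_split_ord /=.
by congr (_ + _).
Qed.

Lemma csum_sum_asum (I : Type) (r : seq I) (M : I -> R) (F : I -> nat -> C) :
  (forall i, asum (M i) (F i)) ->
  asum (\sum_(i <- r) M i) (fun k => \sum_(i <- r) F i k) /\
  csum (fun k => \sum_(i <- r) F i k) = \sum_(i <- r) csum (F i).
Proof.
move=> h; elim: r => [|i r [IH1 IH2]].
  split=> [n|]; first by rewrite big_nil big1 // => k _; rewrite big_nil nc0.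
  rewrite big_nil (@csum_fin 0) ?big_ord0 // => k _; exact: big_nil.
have E : (fun k => \sum_(j <- i :: r) F j k) = (fun k => F i k + \sum_(j <- r) F j k).
  by apply/funext => k; rewrite big_cons.
by rewrite !big_cons E; split; [exact: asumD|rewrite -IH2; exact: csumD (h i) IH1].
Qed.

(* Multiplying each [f p] by the phase that makes its sum nonnegative turns *)
(* the left-hand side into the norm of a single sum.                        *)
Lemma sum_nc_csum (I : finType) (f : I -> nat -> C) (M : R) :
  (forall n, \sum_p \sum_(j < n) nc (f p j) <= M) -> \sum_p nc (csum (f p)) <= M.
Proof.
move=> h; pose w z : C := (nc z)%:C%C * z^-1.
have w1 z : nc (w z) <= 1.
  rewrite ncM nc_real ?nc_ge0 // ncV; have [->|z0] := eqVneq (nc z) 0.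
    by rewrite mul0r ler01.
  by rewrite mulfV.
have wz z : w z * z = (nc z)%:C%C.
  rewrite /w; have [->|z0] := eqVneq z 0; first by rewrite mulr0 nc0.
  by rewrite mulfVK.
have fM p : asum M (f p).
  move=> n; apply: le_trans (h n); rewrite (bigD1 p) //= lerDl.
  by apply: sumr_ge0 => q _; apply: sumr_ge0 => k _; exact: nc_ge0.
have wM p := asumZ (w (csum (f p))) (fM p).
have [_ E] := csum_sum_asum (index_enum I) wM.
have S0 : 0 <= \sum_p nc (csum (f p)) by apply: sumr_ge0 => p _; exact: nc_ge0.
rewrite -(nc_real S0) rmorph_sum /=.
under eq_bigr do rewrite -wz -(csumZ _ (fM _)).
rewrite -E; apply: csum_le => n; apply: le_trans (h n).
rewrite exchange_big /=; apply: ler_sum => k _; apply: le_trans (nc_sum _ _ _) _.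
by apply: ler_sum => p _; rewrite ncM ler_piMl ?nc_ge0.
Qed.

(** N is chosen so that the N-th partial sum is within e of the supremum of all of them. *)
Lemma tail_small (A : nat -> R) M (e : R) : (forall k, 0 <= A k) ->
  (forall n, \sum_(k < n) A k <= M) -> 0 < e ->
  exists N, forall m, \sum_(k < m) A (N + k)%N <= e.
Proof.
move=> A0 AM e0; pose E := [set \sum_(k < n) A k | n in [set: nat]].
have supE : has_sup E.
  split; first by exists (\sum_(k < 0) A k); exists 0%N.
  by exists M => _ [n _ <-].
have [_ [N _ <-] hN] := sup_adherent e0 supE; exists N => m.
have : \sum_(k < N + m) A k <= sup E by apply: ub_le_sup; [case: supE|exists (N + m)%N].
rewrite big_split_ord /= => h; lra.
Qed.

(** Dominated convergence for series: beyond some N both tails are at most e / 3 by domination, and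
    the first N terms converge one by one. *)
Lemma tannery {T} {F : set_system T} {FF : Filter F} (g : T -> nat -> C)
    (g0 : nat -> C) (A : nat -> R) (M : R) :
  (forall n, \sum_(k < n) A k <= M) ->
  (forall k, nc (g0 k) <= A k) ->
  (\forall t \near F, forall k, nc (g t k) <= A k) ->
  (forall k, g ^~ k @ F --> g0 k) ->
  (fun t => csum (g t)) @ F --> csum g0.
Proof.
move=> AM g0A gA gg0; apply/ccvgP => e e0.
have A0 k : 0 <= A k by apply: le_trans (g0A k); exact: nc_ge0.
have e3 : 0 < e / 3 by rewrite divr_gt0.
have [N hN] := tail_small A0 AM e3.
have : (fun t => \sum_(k < N) g t k) @ F --> \sum_(k < N) g0 k.
  elim: N {hN} => [|n IH].
    by rewrite big_ord0 (_ : (fun t => _) = cst 0);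
      [exact: cvg_cst|apply/funext => t; rewrite big_ord0].
  rewrite big_ord_recr /= (_ : (fun t => _) = (fun t => \sum_(k < n) g t k + g t n)).
    exact: cvgD IH (gg0 n).
  by apply/funext => t; rewrite big_ord_recr.
move=> /ccvgP /(_ _ e3) hF; near=> t.
have gtA : forall k, nc (g t k) <= A k by near: t.
have aM f : (forall k, nc (f k) <= A k) -> asum M f.
  by move=> fA n; apply: le_trans (AM n); apply: ler_sum.
have aT f : (forall k, nc (f k) <= A k) -> asum (e / 3) (fun k => f (N + k)%N).
  by move=> fA n; apply: le_trans (hN n); apply: ler_sum.
have h1 : nc (\sum_(k < N) g t k - \sum_(k < N) g0 k) < e / 3 by near: t.
rewrite (csum_split N (aM _ gtA)) (csum_split N (aM _ g0A)).
set a := \sum_(k < N) g t k; set b := \sum_(k < N) g0 k; rewrite -/a -/b in h1.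
have -> x y : a + x - (b + y) = (a - b) + (x - y) by ring.
apply: le_lt_trans (ncD _ _) _.
have h2 := csum_le (aT _ gtA); have h3 := csum_le (aT _ g0A).
have h4 := ncD (csum (fun k => g t (N + k)%N)) (- csum (fun k => g0 (N + k)%N)).
rewrite ncN in h4; lra.
Unshelve. all: by end_near.
Qed.

(** The row bounds are the suprema of the rows, since the common bound M of the rows would not be
    summable. To compare the sum of n of them with M, each row is truncated with an error e / n.+1,
    at one length serving all n rows. *)
Lemma asum_nested M (f : nat -> nat -> C) :
  (forall n m, \sum_(i < n) \sum_(j < m) nc (f i j) <= M) ->
  exists A : nat -> R, [/\ forall i, asum (A i) (f i)
    & forall n, \sum_(i < n) A i <= M].
Proof.
move=> h; pose E i := [set \sum_(j < m) nc (f i j) | m in [set: nat]].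
have fM i : asum M (f i).
  move=> m; apply: le_trans (h i.+1 m); rewrite big_ord_recr /= lerDr.
  by apply: sumr_ge0 => k _; apply: sumr_ge0 => l _; exact: nc_ge0.
have supE i : has_sup (E i).
  split; first by exists (\sum_(j < 0) nc (f i j)); exists 0%N.
  by exists M => _ [m _ <-]; exact: fM.
exists (fun i => sup (E i)); split=> [i m|n].
  apply: ub_le_sup; [by case: (supE i)|by exists m; rewrite ?lexx].
apply/ler_addgt0Pr => e e0.
have e'0 : 0 < e / n.+1%:R by rewrite divr_gt0.
have /= ex i : exists m, sup (E i) - e / n.+1%:R <= \sum_(j < m) nc (f i j).
  by have [_ [m _ <-] /ltW] := sup_adherent e'0 (supE i); exists m.
have [mm hm] := choice ex.
have [m mP] : exists m, forall i, (i < n)%N -> (mm i <= m)%N.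
  exists (\max_(i < n) mm i) => i lin; exact: (@leq_bigmax _ (fun i : 'I_n => mm i) (Ordinal lin)).
apply: le_trans (_ : \sum_(i < n) (\sum_(j < m) nc (f i j) + e / n.+1%:R) <= _).
  apply: ler_sum => i _; rewrite -lerBlDr; apply: le_trans (hm i) _.
  rewrite -(subnKC (mP i (ltn_ord i))) big_split_ord /= lerDl.
  by apply: sumr_ge0 => k _; exact: nc_ge0.
rewrite big_split /= sumr_const card_ord; apply: lerD; first exact: h.
by rewrite -mulrnAr ler_piMr ?(ltW e0) // -mulr_natr mulrC ler_pdivrMr ?ltr0n // mul1r ler_nat.
Qed.

(** Fubini for series: the sums over the first m columns are dominated, row by row, by the bounds of
    [asum_nested], so [tannery] passes to the limit in m. *)
Lemma csum_exchange M (f : nat -> nat -> C) :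
  (forall n m, \sum_(i < n) \sum_(j < m) nc (f i j) <= M) ->
  csum (fun i => csum (fun j => f i j)) = csum (fun j => csum (fun i => f i j)).
Proof.
move=> h; have [A [fA AM]] := asum_nested h.
have fM' j : asum M (fun i => f i j).
  move=> n; apply: le_trans (h n j.+1); apply: ler_sum => i _.
  rewrite big_ord_recr /= lerDr; apply: sumr_ge0 => l _; exact: nc_ge0.
apply/esym/csum_unique.
rewrite (_ : series _ = (fun m => csum (fun i => \sum_(j < m) f i j))); last first.
  by apply/funext => m; rewrite /series /= -(csum_sum_asum (index_iota 0 m) fM').2;
    apply: eq_csum => i; rewrite big_mkord.
apply: (tannery AM).
- by move=> i; exact: csum_le.
- by near=> m => i; apply: le_trans (fA i m); exact: nc_sum.
- move=> i; rewrite (_ : (fun m => _) = series (f i)); first exact: csum_cvg (fA i).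
  by apply/funext => m; rewrite /series /= big_mkord.
Unshelve. all: by end_near.
Qed.

(** The left-hand side runs over the triangle k + j < n, which is part of the square on the right;
    the other terms of the square are nonnegative. *)
Lemma cauchy_sum_le (x y : nat -> R) n : (forall k, 0 <= x k) -> (forall k, 0 <= y k) ->
  \sum_(i < n) \sum_(k < i.+1) x k * y (i - k)%N <=
  (\sum_(k < n) x k) * \sum_(j < n) y j.
Proof.
move=> x0 y0; rewrite mulr_suml.
under [leRHS]eq_bigr do rewrite mulr_sumr.
apply: le_trans (_ : \sum_(i < n) \sum_(k < n | (k <= i)%N) x k * y (i - k)%N <= _).
  apply: ler_sum => i _.
  by rewrite (big_ord_widen_cond n xpredT (fun k => x k * y (i - k)%N) (ltn_ord i)).
rewrite (exchange_big_dep xpredT) //=; apply: ler_sum => k _.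
rewrite -(big_mkord (fun i => (k <= i)%N) (fun i => x k * y (i - k)%N)).
rewrite (big_cat_nat (n := k)) ?(ltnW (ltn_ord k)) //=.
rewrite big_nat_cond big_pred0 ?add0r; last by move=> i; apply/negP; lia.
rewrite -{1}[k : nat]add0n big_addn.
rewrite -[leRHS](big_mkord xpredT (fun j => x k * y j)).
rewrite [leRHS](big_cat_nat (n := (n - k)%N)) ?leq_subr //=.
rewrite -[leLHS]addr0; apply: lerD.
  by rewrite big_mkcond /=; apply: ler_sum => i _; rewrite leq_addl addnK.
by apply: sumr_ge0 => i _; rewrite mulr_ge0.
Qed.

Lemma asum_cauchy M N f g : asum M f -> asum N g ->
  asum (M * N) (fun n => \sum_(k < n.+1) f k * g (n - k)%N).
Proof.
move=> fM gN n; apply: le_trans (_ : (\sum_(k < n) nc (f k)) * (\sum_(k < n) nc (g k)) <= _).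
  apply: le_trans (cauchy_sum_le n (fun k => nc_ge0 (f k)) (fun k => nc_ge0 (g k))).
  apply: ler_sum => i _; apply: le_trans (nc_sum _ _ _) _.
  by under eq_bigr do rewrite ncM.
by apply: ler_pM; [| |exact: fM|exact: gN]; apply: sumr_ge0 => k _; exact: nc_ge0.
Qed.

(** The Cauchy product is the row sum of the triangular array [F]; summed by columns, the array
    factors. *)
Lemma csum_cauchy M N f g : asum M f -> asum N g ->
  csum (fun n => \sum_(k < n.+1) f k * g (n - k)%N) = csum f * csum g.
Proof.
move=> fM gN.
pose F n k := if (k <= n)%N then f k * g (n - k)%N else 0.
have -> : csum (fun n => \sum_(k < n.+1) f k * g (n - k)%N) = csum (fun n => csum (F n)).
  apply: eq_csum => n; rewrite (@csum_fin n.+1).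
    by apply: eq_bigr => k _; rewrite /F -ltnS ltn_ord.
  by move=> k nk; rewrite /F leqNgt nk.
rewrite (@csum_exchange (M * N)).
  rewrite mulrC -(csumZ _ fM); apply: eq_csum => k.
  have gN' : asum N (fun n => if (k <= n)%N then g (n - k)%N else 0).
    move=> n; have [nk|kn] := leqP n k.
      rewrite big1 ?(asum_ge0 gN) // => i _.
      by rewrite leqNgt (leq_trans (ltn_ord i) nk) nc0.
    rewrite -(subnKC (ltnW kn)) big_split_ord /= big1 ?add0r => [|i _].
      by apply: le_trans (gN (n - k)%N); apply: ler_sum => i _; rewrite leq_addr addKn.
    by rewrite leqNgt ltn_ord nc0.
  transitivity (csum (fun n => f k * (if (k <= n)%N then g (n - k)%N else 0))).
    by apply: eq_csum => n; rewrite /F; case: ifP => //; rewrite mulr0.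
  rewrite (csumZ _ gN') mulrC; congr (_ * _).
  rewrite (csum_split k gN') big1 ?add0r => [|i _].
    by apply: eq_csum => i; rewrite leq_addr addKn.
  by rewrite leqNgt ltn_ord.
move=> n m.
(* [asum_cauchy] is applied to the moduli, seen as complex numbers, because the finite rectangles of
   [F] have to be bounded in absolute value and not only their row sums. *)
have fM' : asum M (fun k => (nc (f k))%:C%C).
  by move=> p; under eq_bigr do rewrite nc_real ?nc_ge0 //; exact: fM.
have gN' : asum N (fun k => (nc (g k))%:C%C).
  by move=> p; under eq_bigr do rewrite nc_real ?nc_ge0 //; exact: gN.
apply: le_trans (asum_cauchy fM' gN' n); apply: ler_sum => i _.
under [in leRHS]eq_bigr do rewrite -rmorphM.
rewrite -rmorph_sum nc_real; last by apply: sumr_ge0 => k _; rewrite mulr_ge0 ?nc_ge0.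
rewrite -(big_mkord xpredT (fun k => nc (F i k))).
rewrite -[leRHS](big_mkord xpredT (fun k => nc (f k) * nc (g (i - k)%N))).
apply: le_trans (_ : \sum_(0 <= k < m + i.+1) nc (F i k) <= _).
  rewrite [leRHS](big_cat_nat (n := m)) ?leq_addr //= lerDl.
  by apply: sumr_ge0 => k _; exact: nc_ge0.
rewrite (big_cat_nat (n := i.+1)) ?leq_addl //= [X in _ + X]big1_seq ?addr0.
  by rewrite !big_mkord; apply: ler_sum => k _; rewrite /F -ltnS ltn_ord ncM.
move=> k /andP[_]; rewrite mem_index_iota => /andP[ik _].
by rewrite /F leqNgt ik nc0.
Qed.

End ComplexSums.

(** * Weighted norms and power series in one variable *)

Section Seminorms.
Variable R : realType.
Local Notation C := R[i].
Local Notation nc := (@Normc.normc R).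

(** The same estimates are needed over C and for series in one and two variables. [semi1] is an
    inequality because a norm truncated to no coefficient at all is identically 0. *)
Record seminorm (K : comNzRingType) (nu : K -> R) : Prop := Seminorm {
  semi_ge0 : forall x, 0 <= nu x;
  semi0 : nu 0 = 0;
  semi1 : nu 1 <= 1;
  semiN : forall x, nu (- x) = nu x;
  semiD : forall x y, nu (x + y) <= nu x + nu y;
  semiM : forall x y, nu (x * y) <= nu x * nu y }.

Lemma nc_seminorm : seminorm nc.
Proof.
split; [exact: nc_ge0|exact: nc0|by rewrite nc1|exact: ncN|exact: ncD|].
by move=> x y; rewrite ncM.
Qed.

Section Theory.
Variables (K : comNzRingType) (nu : K -> R).
Hypothesis nuS : seminorm nu.

Lemma semi_sum I (r : seq I) (P : pred I) (F : I -> K) :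
  nu (\sum_(i <- r | P i) F i) <= \sum_(i <- r | P i) nu (F i).
Proof.
elim/big_rec2: _ => [|i y x _ h]; first by rewrite (semi0 nuS).
by apply: le_trans (semiD nuS _ _) _; rewrite lerD2l.
Qed.

Lemma semiM_le (x y : K) a b : nu x <= a -> nu y <= b -> nu (x * y) <= a * b.
Proof.
move=> xa yb; apply: le_trans (semiM nuS _ _) _.
by apply: ler_pM; rewrite ?(semi_ge0 nuS).
Qed.

Lemma semiD_le (x y : K) a b : nu x <= a -> nu y <= b -> nu (x + y) <= a + b.
Proof. by move=> xa yb; apply: le_trans (semiD nuS _ _) _; exact: lerD. Qed.

Lemma semiX_le (x : K) a n : nu x <= a -> nu (x ^+ n) <= a ^+ n.
Proof.
move=> xa; elim: n => [|n IH]; first by rewrite !expr0 (semi1 nuS).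
by rewrite !exprS; exact: semiM_le.
Qed.

(** Weighted l^1 norm of the part of degree below n. Truncation keeps it submultiplicative, because
    the low coefficients of a product only involve low coefficients of the factors. *)
Definition wnorm (r : R) (n : nat) (a : fps K) : R :=
  \sum_(k < n) nu (fcoef a k) * r ^+ k.

Lemma wnorm_seminorm r n : 0 <= r -> seminorm (wnorm r n).
Proof.
move=> r0; have rk k : 0 <= r ^+ k by exact: exprn_ge0.
have n0 x k : 0 <= nu x * r ^+ k by rewrite mulr_ge0 ?(semi_ge0 nuS).
split.
- by move=> a; apply: sumr_ge0 => k _.
- by rewrite /wnorm big1 // => k _; rewrite fcoef0 (semi0 nuS) mul0r.
- rewrite /wnorm; case: n => [|n]; first by rewrite big_ord0.
  rewrite big_ord_recl big1 => [|k _]; last by rewrite fcoef1 (semi0 nuS) mul0r.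
  by rewrite fcoef1 expr0 mulr1 addr0 (semi1 nuS).
- by move=> a; apply: eq_bigr => k _; rewrite fcoefN (semiN nuS).
- move=> a b; rewrite /wnorm -big_split; apply: ler_sum => k _.
  by rewrite fcoefD -[leRHS]mulrDl ler_wpM2r ?(semiD nuS).
- move=> a b; rewrite /wnorm.
  apply: le_trans (cauchy_sum_le n (fun k => n0 (fcoef a k) k) (fun k => n0 (fcoef b k) k)).
  apply: ler_sum => i _; rewrite fcoefM.
  apply: le_trans (ler_wpM2r (rk i) (semi_sum _ _ _)) _.
  rewrite mulr_suml; apply: ler_sum => k _.
  have -> : r ^+ i = r ^+ k * r ^+ (i - k) by rewrite -exprD subnKC // -ltnS.
  by rewrite mulrACA ler_wpM2r ?mulr_ge0 ?(semiM nuS).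
Qed.

End Theory.

Definition fpsC (K : comNzRingType) (c : K) : fps K :=
  Fps (fun n => if n is 0%N then c else 0).

Lemma fcoefCM (K : comNzRingType) (c : K) (a : fps K) n :
  fcoef (fpsC c * a) n = c * fcoef a n.
Proof.
rewrite fcoefM big_ord_recl /= subn0 big1 ?addr0 // => i _; rewrite mul0r //.
Qed.

Lemma wnormC (K : comNzRingType) (nu : K -> R) r n c :
  seminorm nu -> wnorm nu r n (fpsC c) <= nu c.
Proof.
move=> nuS; rewrite /wnorm; case: n => [|n]; first by rewrite big_ord0 (semi_ge0 nuS).
by rewrite big_ord_recl expr0 mulr1 big1 ?addr0 // => k _; rewrite /= (semi0 nuS) mul0r.
Qed.

Lemma geometric_sum_le (q : R) n : 0 <= q -> q < 1 -> \sum_(k < n) q ^+ k <= (1 - q)^-1.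
Proof.
move=> q0 q1; have q1' : 0 < 1 - q by rewrite subr_gt0.
rewrite -(ler_pM2l q1') divff ?gt_eqF // -opprB mulNr -subrX1 opprB.
by rewrite gerBl exprn_ge0.
Qed.

Definition ev (s : C) (a : fps C) : C := csum (fun n => fcoef a n * s ^+ n).

Section Evaluation.
Variables (r : R) (s : C).
Hypothesis sr : nc s <= r.

Lemma wnorm_asum M (a : fps C) : (forall n, wnorm nc r n a <= M) ->
  asum M (fun n => fcoef a n * s ^+ n).
Proof.
move=> h n; apply: le_trans (h n); apply: ler_sum => k _.
rewrite ncM ncX ler_wpM2l ?nc_ge0 // lerXn2r // nnegrE ?nc_ge0 //.
exact: le_trans (nc_ge0 s) sr.
Qed.

Lemma evM M N (a b : fps C) : (forall n, wnorm nc r n a <= M) ->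
  (forall n, wnorm nc r n b <= N) -> ev s (a * b) = ev s a * ev s b.
Proof.
move=> /wnorm_asum aM /wnorm_asum bN; rewrite /ev -(csum_cauchy aM bN).
apply: eq_csum => n; rewrite fcoefM mulr_suml; apply: eq_bigr => k _.
have -> : s ^+ n = s ^+ k * s ^+ (n - k) by rewrite -exprD subnKC // -ltnS.
by rewrite mulrACA.
Qed.

Lemma ev_le M (a : fps C) : (forall n, wnorm nc r n a <= M) -> nc (ev s a) <= M.
Proof. by move=> /wnorm_asum; exact: csum_le. Qed.

Lemma evC c : ev s (fpsC c) = c.
Proof.
rewrite /ev (@csum_fin _ 1) ?big_ord1 ?mulr1 // => -[//|k] _; exact: mul0r.
Qed.

Lemma evX M (a : fps C) n : (forall n, wnorm nc r n a <= M) -> ev s (a ^+ n) = ev s a ^+ n.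
Proof.
have r0 : 0 <= r := le_trans (nc_ge0 s) sr.
move=> aM; elim: n => [|n IH]; last first.
  rewrite !exprS (evM aM (N := M ^+ n)) ?IH // => m.
  exact: (semiX_le (wnorm_seminorm nc_seminorm _ r0)).
rewrite !expr0 -[RHS](evC 1); congr ev; apply/fpsP => -[|k] //.
Qed.

End Evaluation.

Lemma ev0 (a : fps C) : ev 0 a = fcoef a 0.
Proof.
by rewrite /ev (@csum_fin _ 1) ?big_ord1 ?expr0 ?mulr1 // => -[//|k] _; rewrite expr0n mulr0.
Qed.

Definition fderiv (a : fps C) : fps C := Fps (fun n => n.+1%:R * fcoef a n.+1).

(** In [r ^+ n.+1 - t ^+ n.+1 = (r - t) * \sum_i r ^+ (n - i) * t ^+ i] each of the n.+1 summands is
    at least [t ^+ n]. This is the price of a derivative when the radius shrinks from r to t. *)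
Lemma deriv_weight_le (t r : R) n : 0 <= t -> t < r -> n.+1%:R * t ^+ n <= r ^+ n.+1 / (r - t).
Proof.
move=> t0 tr; have rt : 0 < r - t by rewrite subr_gt0.
have r0 : 0 <= r by apply: ltW; exact: le_lt_trans tr.
rewrite ler_pdivlMr //.
apply: le_trans (_ : r ^+ n.+1 - t ^+ n.+1 <= _); last by rewrite gerBl exprn_ge0.
rewrite subrXX /= mulrC ler_pM2l // mulr_natl -[X in _ *+ X]card_ord -sumr_const.
apply: ler_sum => i _.
have -> : t ^+ n = t ^+ (n - i) * t ^+ i by rewrite -exprD subnK // -ltnS.
by rewrite ler_wpM2r ?exprn_ge0 // lerXn2r // ?nnegrE // ltW.
Qed.

Lemma wnorm_fderiv (t r : R) M (a : fps C) : 0 <= t -> t < r ->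
  (forall n, wnorm nc r n a <= M) -> forall n, wnorm nc t n (fderiv a) <= M / (r - t).
Proof.
move=> t0 tr aM n; have rt : 0 < r - t by rewrite subr_gt0.
apply: le_trans (_ : \sum_(k < n) nc (fcoef a k.+1) * (r ^+ k.+1 / (r - t)) <= _).
  apply: ler_sum => k _; rewrite /= ncM nc_nat [_ * nc _]mulrC -mulrA ler_wpM2l ?nc_ge0 //.
  exact: deriv_weight_le.
under eq_bigr do rewrite mulrA.
rewrite -mulr_suml ler_pM2r ?invr_gt0 //; apply: le_trans (aM n.+1).
rewrite /wnorm big_ord_recl lerDr mulr_ge0 ?nc_ge0 ?expr0 //.
Qed.

(** * Complex derivatives of convergent power series *)

Lemma is_derive_ratioP (f : C -> C) (x l : C) :
  (fun h => h^-1 * (f (h + x) - f x)) @ 0^' --> l -> is_derive x 1 f l.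
Proof.
move=> h.
have h' : (fun h : C => h^-1 *: (f (h *: 1 + x) - f x)) @ 0^' --> l.
  by under eq_fun do rewrite [_ *: 1]mulr1.
split; first by apply/cvg_ex; exists l.
exact: cvg_lim.
Qed.

Lemma is_derive_ratio (f : C -> C) (x l : C) : is_derive x 1 f l ->
  (fun h => h^-1 * (f (h + x) - f x)) @ 0^' --> l.
Proof.
case=> /cvg_ex[l' /= hl'] <-; rewrite /derive (cvg_lim _ hl') //.
by under eq_fun do rewrite -[X in f (X + x)]mulr1.
Qed.

Lemma is_derive1E (f : C -> C) (x l : C) : is_derive x 1 f l -> derive1 f x = l.
Proof. by move=> h; rewrite derive1E derive_val. Qed.

Lemma is_derive_mul (f g : C -> C) (x a b : C) : is_derive x 1 f a -> is_derive x 1 g b ->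
  is_derive x 1 (fun y => f y * g y) (a * g x + f x * b).
Proof.
move=> fa gb; apply: is_derive_eq (is_deriveM fa gb) _.
by rewrite addrC [_ *: a]mulrC.
Qed.

Lemma is_derive_add (f g : C -> C) (x a b : C) : is_derive x 1 f a -> is_derive x 1 g b ->
  is_derive x 1 (fun y => f y + g y) (a + b).
Proof. by move=> fa gb; exact: is_deriveD. Qed.

Lemma is_derive_scale (c : C) (f : C -> C) (x a : C) : is_derive x 1 f a ->
  is_derive x 1 (fun y => c * f y) (c * a).
Proof.
by move=> fa; apply: is_derive_eq (is_derive_mul (is_derive_cst c x 1) fa) _; rewrite mul0r add0r.
Qed.

Lemma is_derive_translate_pow (x0 x : C) n :
  is_derive x 1 (fun y => (y - x0) ^+ n) (n%:R * (x - x0) ^+ n.-1).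
Proof.
have h : is_derive x 1 (fun y : C => y - x0) 1.
  by apply: is_derive_eq (is_derive_add (is_derive_id x 1) (is_derive_cst (- x0) x 1)) _; rewrite addr0.
elim: n => [|n IH].
  by rewrite mul0r; under eq_fun do rewrite expr0; exact: is_derive_cst.
under eq_fun do rewrite exprS.
apply: is_derive_eq (is_derive_mul h IH) _; case: n {IH} => [|n] /=; first by ring.
by rewrite exprS -[n.+2%:R]natr1 -[n.+1%:R]natr1; ring.
Qed.

(** Termwise differentiation by [tannery]. For t halfway between [nc (x - x0)] and r, the difference
    quotients of the n-th power and their limit are at most [n%:R * t ^+ n.-1], which
    [deriv_weight_le] makes summable against the coefficients. *)
Lemma ev_is_derive (r : R) M (a : fps C) (x0 x : C) :
  (forall n, wnorm nc r n a <= M) -> nc (x - x0) < r ->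
  is_derive x 1 (fun y => ev (y - x0) a) (ev (x - x0) (fderiv a)).
Proof.
move=> aM xr; apply: is_derive_ratioP.
pose t := (nc (x - x0) + r) / 2.
have x0' := nc_ge0 (x - x0).
have [t0 tr xt] : [/\ 0 <= t, t < r & nc (x - x0) < t] by split; rewrite /t; lra.
have rt : 0 < r - t by rewrite subr_gt0.
pose q n h : C := h^-1 * ((h + x - x0) ^+ n - (x - x0) ^+ n).
pose w n : C := n%:R * (x - x0) ^+ n.-1.
have wE n : nc (w n) <= n%:R * t ^+ n.-1.
  rewrite ncM nc_nat ler_wpM2l // ncX.
  by rewrite lerXn2r ?nnegrE // ltW.
have bound n : n%:R * t ^+ n.-1 <= r ^+ n / (r - t).
  case: n => [|n]; first by rewrite mul0r expr0 divr_ge0 // ltW.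
  exact: deriv_weight_le.
have near_t : \forall h \near 0^', h != 0 /\ nc (h + x - x0) < t.
  apply: filterI; first exact: nbhs_dnbhs_neq.
  apply: nbhs_dnbhs; apply/near_ncP; exists (t - nc (x - x0)); first by rewrite subr_gt0.
  move=> h; rewrite subr0 => hh; rewrite -addrA; apply: le_lt_trans (ncD _ _) _; lra.
have -> : ev (x - x0) (fderiv a) = csum (fun n => fcoef a n * w n).
  have aw : asum (M / (r - t)) (fun n => fcoef a n * w n).
    move=> n; apply: le_trans (_ : \sum_(k < n) nc (fcoef a k) * (r ^+ k / (r - t)) <= _).
      apply: ler_sum => k _; rewrite ncM ler_wpM2l ?nc_ge0 //.
      exact: le_trans (wE k) (bound k).
    under eq_bigr do rewrite mulrA.
    by rewrite -mulr_suml ler_pM2r ?invr_gt0 //; exact: aM.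
  rewrite (csum_split 1 aw) big_ord1 /w mul0r mulr0 add0r.
  by apply: eq_csum => n; rewrite add1n /= mulrCA mulrA.
(* The two functions agree only for small nonzero h, so their limits are compared as filters. *)
have -> : (fun h => h^-1 * (ev (h + x - x0) a - ev (x - x0) a)) @ 0^' =
   (fun h => csum (fun n => fcoef a n * q n h)) @ 0^'.
  rewrite eqEsubset; split; apply: near_eq_cvg; apply: filterS near_t => h [h0 ht];
    have a1 := wnorm_asum (ltW (lt_trans ht tr)) aM;
    have a2 := wnorm_asum (ltW xr) aM;
    rewrite /ev -[X in _ - X]mul1r -mulNr -(csumZ _ a2) -(csumD a1 (asumZ _ a2));
    rewrite -(csumZ _ (asumD a1 (asumZ _ a2))); first symmetry;
    by apply: eq_csum => n; rewrite /q; ring.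
apply: (tannery (A := fun n => nc (fcoef a n) * (r ^+ n / (r - t))) (M := M / (r - t))).
- move=> n; under eq_bigr do rewrite mulrA.
  by rewrite -mulr_suml ler_pM2r ?invr_gt0 //; exact: aM.
- by move=> n; rewrite ncM ler_wpM2l ?nc_ge0 //; exact: le_trans (wE n) (bound n).
- apply: filterS near_t => h [h0 ht] n; rewrite ncM ler_wpM2l ?nc_ge0 //.
  apply: le_trans (bound n); rewrite /q subrXX (_ : h + x - x0 - (x - x0) = h); last by ring.
  rewrite mulKf //; apply: le_trans (nc_sum _ _ _) _.
  rewrite mulr_natl -[X in _ *+ X]card_ord -sumr_const.
  apply: ler_sum => i _; rewrite ncM !ncX.
  have -> : t ^+ n.-1 = t ^+ (n.-1 - i) * t ^+ i.
    by rewrite -exprD subnK //; have := ltn_ord i; lia.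
  by apply: ler_pM; rewrite ?exprn_ge0 ?nc_ge0 // lerXn2r ?nnegrE ?nc_ge0 // ltW.
- move=> n; apply: cvgM; first exact: cvg_cst.
  by have := is_derive_ratio (is_derive_translate_pow x0 x n).
Qed.

Lemma is_derive_near_ne0 (f : C -> C) (x l : C) : is_derive x 1 f l -> f x != 0 ->
  \forall y \near x, f y != 0.
Proof.
move=> [/derivable1_diffP/differentiable_continuous cf _] fx0.
suff : nbhs (f x) [set z | z != 0] by move=> /cf.
apply/near_ncP; exists (nc (f x)); first by rewrite nc_gt0.
by move=> y h; apply/eqP => y0; move: h; rewrite y0 sub0r ncN ltxx.
Qed.

(** Abel's lemma: the terms of a convergent series are bounded, and halving the radius makes them
    decay like the powers of 1/2. *)
Lemma cvg_series_wnorm (c : nat -> C) (s : C) : s != 0 -> cvgn (series (fun n => c n * s ^+ n)) ->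
  exists M, forall n, wnorm nc (nc s / 2) n (Fps c) <= M.
Proof.
move=> s0 /cvg_series_cvg_0/ccvgP/(_ 1 ltr01)[N _ hN].
pose B := 1 + \sum_(k < N) nc (c k * s ^+ k).
have BP n : nc (c n * s ^+ n) <= B.
  have [nN|Nn] := ltnP n N.
    rewrite /B (bigD1 (Ordinal nN)) //= addrCA lerDl addr_ge0 //.
    by apply: sumr_ge0 => *; exact: nc_ge0.
  have /= := hN n Nn; rewrite subr0 => /ltW h; apply: le_trans h _.
  by rewrite lerDl; apply: sumr_ge0 => *; exact: nc_ge0.
have B0 : 0 <= B := le_trans (nc_ge0 _) (BP 0%N).
exists (B * (1 - 2^-1)^-1) => n.
apply: le_trans (_ : B * \sum_(k < n) 2^-1 ^+ k <= _); last first.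
  by rewrite ler_wpM2l // geometric_sum_le ?invr_ge0 // invf_lt1 ?ltr1n.
rewrite mulr_sumr; apply: ler_sum => k _ /=.
by rewrite exprMn mulrA -ncX -ncM ler_wpM2r ?exprn_ge0 ?invr_ge0.
Qed.

(** [derive1] is total and carries information only for differentiable functions; this is where the
    analyticity required of integral curves supplies differentiability. *)
Lemma analytic_twice_derivable (u : C -> C) (x0 : C) : analytic_at u x0 ->
  (\forall x \near x0, is_derive (x : C) 1 u (derive1 u x)) /\
  is_derive x0 1 (derive1 u) (derive1n 2 u x0).
Proof.
move=> [c /near_ncP[e e0 uc]].
pose s : C := (e / 2)%:C%C.
have e2 : 0 < e / 2 by rewrite divr_gt0.
have ns : nc s = e / 2 by rewrite nc_real // ltW.
have [M aM] : exists M, forall n, wnorm nc (nc s / 2) n (Fps c) <= M.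
  apply: cvg_series_wnorm; first by rewrite -nc_gt0 ns.
  have := uc (s + x0); rewrite addrK => h; apply/cvg_ex; exists (u (s + x0)); apply: h.
  rewrite ns; lra.
have uE x : nc (x - x0) < e -> u x = ev (x - x0) (Fps c).
  by move=> /uc h; rewrite /ev (csum_unique h).
(* Convergence at distance e / 2 gives absolute bounds at radius e / 4; the second derivative uses
   up another half. *)
rewrite ns in aM; set r := e / 2 / 2 in aM.
have r0 : 0 < r by rewrite !divr_gt0.
have re : r < e by rewrite /r; lra.
have nbr (d : R) x : nc (x - x0) < d -> \forall y \near x, nc (y - x0) < d.
  move=> xd; apply/near_ncP; exists (d - nc (x - x0)); first by rewrite subr_gt0.
  move=> y yx; rewrite -(subrK x y) -addrA; apply: le_lt_trans (ncD _ _) _; lra.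
have du (x : C) : nc (x - x0) < r -> is_derive x 1 u (ev (x - x0) (fderiv (Fps c))).
  move=> xr; apply: near_eq_is_derive (ev_is_derive aM xr).
  by apply: filterS (nbr e x (lt_trans xr re)) => y /uE ->.
have d1u x : nc (x - x0) < r -> derive1 u x = ev (x - x0) (fderiv (Fps c)).
  by move=> /du; exact: is_derive1E.
split.
  apply/near_ncP; exists r; first exact: r0.
  by move=> x xr; rewrite (d1u _ xr); exact: du.
have r2 : 0 <= r / 2 by rewrite divr_ge0 // ltW.
have r2r : r / 2 < r by rewrite ltr_pdivrMr // ltr_pMr // ltr1n.
have h := @ev_is_derive _ _ _ x0 x0 (wnorm_fderiv r2 r2r aM) _.
rewrite subrr nc0 in h; have {}h := h (divr_gt0 r0 (ltr0Sn _ 1)).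
have h' : is_derive x0 1 (derive1 u) (ev 0 (fderiv (fderiv (Fps c)))).
  apply: near_eq_is_derive h.
  by apply: filterS (nbr r x0 _) => [y /d1u ->|]; rewrite ?subrr ?nc0.
by rewrite [derive1n 2 u x0](is_derive1E h').
Qed.

End Seminorms.

(** * Germs near the origin *)

Section GermEvaluation.
Variable R : realType.
Local Notation C := R[i].
Local Notation nc := (@Normc.normc R).
Local Notation ncS := (nc_seminorm R).
Implicit Types (a b : fps (fps C)) (x u : C).

(** [r] and [n] belong to x, the outer variable, [s] and [m] to u. *)
Definition dnorm (r s : R) n m a : R := wnorm (wnorm nc s m) r n a.

Definition dom (r s A : R) a : Prop := forall n m, dnorm r s n m a <= A.

Lemma dnormE r s n m a :
  dnorm r s n m a = \sum_(i < n) \sum_(j < m) nc (coef2 a i j) * s ^+ j * r ^+ i.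
Proof. by apply: eq_bigr => i _; rewrite /wnorm mulr_suml. Qed.

Lemma dnorm_seminorm r s n m : 0 <= r -> 0 <= s -> seminorm (dnorm r s n m).
Proof. by move=> r0 s0; apply: wnorm_seminorm r0; apply: wnorm_seminorm s0; exact: ncS. Qed.

Lemma dom_le r s r' s' A a : 0 <= r' -> r' <= r -> 0 <= s' -> s' <= s -> dom r s A a -> dom r' s' A a.
Proof.
move=> r'0 rr s'0 ss aA n m; apply: le_trans (aA n m); rewrite !dnormE.
apply: ler_sum => i _; apply: ler_sum => j _.
have r0 := le_trans r'0 rr; have s0 := le_trans s'0 ss.
rewrite -!mulrA ler_wpM2l ?nc_ge0 //.
by apply: ler_pM; rewrite ?exprn_ge0 // lerXn2r.
Qed.

Lemma dom_ge0 r s A a : dom r s A a -> 0 <= A.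
Proof. by move=> /(_ 0%N 0%N); rewrite /dnorm /wnorm big_ord0. Qed.

Lemma dom_term r s A a i j : 0 <= r -> 0 <= s -> dom r s A a ->
  nc (coef2 a i j) * s ^+ j * r ^+ i <= A.
Proof.
move=> r0 s0 aA; apply: le_trans (aA i.+1 j.+1); rewrite dnormE.
have p k l : 0 <= nc (coef2 a k l) * s ^+ l * r ^+ k by rewrite !mulr_ge0 ?exprn_ge0 ?nc_ge0.
rewrite big_ord_recr /= big_ord_recr /= addrA lerDr addr_ge0 //.
  by apply: sumr_ge0 => k _; apply: sumr_ge0.
by apply: sumr_ge0.
Qed.

(** On a smaller bidisc, bounded terms are dominated by a product of two geometric series. *)
Lemma bounded_dom a (r s r' s' : R) : bounded_on (coef2 a) r%:C%C s%:C%C ->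
  0 <= r' -> r' < r -> 0 <= s' -> s' < s -> exists A, dom r' s' A a.
Proof.
move=> [M0 aM0] r'0 rr s'0 ss.
have r0 := le_lt_trans r'0 rr; have s0 := le_lt_trans s'0 ss.
pose M := complex.Re M0.
have aM i j : nc (coef2 a i j) * r ^+ i * s ^+ j <= M.
  by have := aM0 i j; rewrite nc_norm -!rmorphXn -!rmorphM lecE => /andP[_].
have M00 : 0 <= M by have := aM 0%N 0%N; rewrite !expr0 !mulr1; apply: le_trans; exact: nc_ge0.
have q (x y : R) : 0 <= x -> x < y -> 0 <= x / y /\ x / y < 1.
  move=> x0 xy; have y0 := le_lt_trans x0 xy.
  by rewrite divr_ge0 ?ltr_pdivrMr ?mul1r // ltW.
have [q0 q1] := q _ _ r'0 rr; have [p0 p1] := q _ _ s'0 ss.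
exists (M * ((1 - s' / s)^-1 * (1 - r' / r)^-1)) => n m; rewrite dnormE.
apply: le_trans (_ : M * ((\sum_(j < m) (s' / s) ^+ j) * \sum_(i < n) (r' / r) ^+ i) <= _).
  rewrite mulrC mulr_sumr mulr_suml; apply: ler_sum => i _; rewrite mulr_suml mulr_suml.
  apply: ler_sum => j _.
  rewrite [leRHS](_ : _ = M / (r ^+ i * s ^+ j) * (s' ^+ j * r' ^+ i)).
    rewrite -mulrA ler_wpM2r ?mulr_ge0 ?exprn_ge0 //.
    by rewrite ler_pdivlMr ?mulr_gt0 ?exprn_gt0 // mulrA.
  rewrite !expr_div_n invfM; ring.
rewrite ler_wpM2l //; apply: ler_pM; rewrite ?geometric_sum_le //;
  by apply: sumr_ge0 => *; exact: exprn_ge0.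
Qed.

Lemma in_polydisc_dom (g : germ R) (P : C * C) : in_polydisc g P ->
  exists r s A, [/\ 0 < r, nc P.1 <= r, nc P.2 <= s & dom r s A g].
Proof.
move=> [r [s []]]; rewrite !nc_lt => /andP[/eqP rE Pr] /andP[/eqP sE Ps].
rewrite rE sE => gb.
set r' := complex.Re r in gb Pr; set s' := complex.Re s in gb Ps.
have P10 := nc_ge0 P.1; have P20 := nc_ge0 P.2.
(* The radius in x must be positive, since [dom_row] divides by its powers; the radius in u may be
   [nc P.2] itself, even 0. *)
have r0 : 0 < (nc P.1 + r') / 2 by lra.
have r1 : (nc P.1 + r') / 2 < r' by lra.
have [A gA] := bounded_dom gb (ltW r0) r1 P20 Ps.
by exists ((nc P.1 + r') / 2), (nc P.2), A; split => //; lra.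
Qed.

Lemma dom_in_polydisc (t A : R) (g : germ R) (P : C * C) : 0 <= t -> dom t t A g ->
  nc P.1 < t -> nc P.2 < t -> in_polydisc g P.
Proof.
move=> t0 gA P1 P2; exists t%:C%C, t%:C%C; rewrite !nc_norm !ltcR; split=> //.
exists A%:C%C => i j; rewrite nc_norm -!rmorphXn -!rmorphM lecR mulrAC.
exact: dom_term.
Qed.

Lemma germ_dom (g : germ R) : exists t A, 0 < t /\ dom t t A g.
Proof.
have /asboolP[r [r0 gr]] := valP g.
have rE : r = (complex.Re r)%:C%C by rewrite RRe_real // gtr0_real.
set r' := complex.Re r in rE; have r'0 : 0 < r' by rewrite -ltcR -rE.
have r1 : 0 <= r' / 2 by lra.
have r2 : r' / 2 < r' by lra.
rewrite rE in gr; have [A gA] := bounded_dom gr r1 r2 r1 r2.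
by exists (r' / 2), A; split=> //; rewrite divr_gt0.
Qed.

Definition ev_inner (u : C) a : fps C := Fps (fun i => ev u (fcoef a i)).

Lemma germ_evalE (g : germ R) (P : C * C) : germ_eval g P = ev P.1 (ev_inner P.2 g).
Proof. by []. Qed.

Lemma dom_row r s A a i n : 0 < r -> 0 <= s -> dom r s A a ->
  wnorm nc s n (fcoef a i) <= A / r ^+ i.
Proof.
move=> r0 s0 aA; rewrite ler_pdivlMr ?exprn_gt0 //; apply: le_trans (aA i.+1 n).
rewrite /dnorm [leRHS]big_ord_recr /= lerDr.
apply: sumr_ge0 => k _; rewrite mulr_ge0 ?exprn_ge0 ?(ltW r0) //.
exact: semi_ge0 (wnorm_seminorm ncS n s0) _.
Qed.

Lemma wnorm_ev_inner r s A a u : 0 < r -> nc u <= s -> dom r s A a ->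
  forall n, wnorm nc r n (ev_inner u a) <= A.
Proof.
move=> r0 us aA n; have s0 := le_trans (nc_ge0 u) us.
(* The weight is moved inside the inner series so that [sum_nc_csum] bounds the finite sum of
   moduli. *)
pose f (i : 'I_n) j := (r ^+ i)%:C%C * (coef2 a i j * u ^+ j).
have -> : wnorm nc r n (ev_inner u a) = \sum_i nc (csum (f i)).
  apply: eq_bigr => i _.
  have h := wnorm_asum us (fun m => dom_row i m r0 s0 aA).
  by rewrite (csumZ _ h) ncM nc_real ?exprn_ge0 ?(ltW r0) // mulrC.
apply: sum_nc_csum => m; apply: le_trans (aA n m); rewrite dnormE.
apply: ler_sum => i _; apply: ler_sum => j _.
rewrite !ncM nc_real ?exprn_ge0 ?(ltW r0) // mulrC ler_wpM2r ?exprn_ge0 ?(ltW r0) //.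
by rewrite ler_wpM2l ?nc_ge0 // ncX lerXn2r ?nnegrE ?nc_ge0.
Qed.

Lemma ev_innerM r s A B a b u : 0 < r -> nc u <= s -> dom r s A a -> dom r s B b ->
  ev_inner u (a * b) = ev_inner u a * ev_inner u b.
Proof.
move=> r0 us aA bB; have s0 := le_trans (nc_ge0 u) us.
apply/fpsP => n; rewrite [RHS]fcoefM.
have h k := wnorm_asum us (fun m => le_trans
   (semiM_le (wnorm_seminorm ncS m s0) (dom_row k m r0 s0 aA) (dom_row (n - k) m r0 s0 bB)) (lexx _)).
have [_ E] := csum_sum_asum (index_enum 'I_n.+1) (fun k : 'I_n.+1 => h k).
transitivity (\sum_(k < n.+1) ev u (fcoef a k * fcoef b (n - k)%N)).
  by rewrite -E; apply: eq_csum => j; rewrite fcoefM fcoef_sum mulr_suml.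
apply: eq_bigr => k _.
by rewrite (evM us (fun m => dom_row k m r0 s0 aA) (fun m => dom_row (n - k) m r0 s0 bB)).
Qed.

Lemma germ_evalM (g h : germ R) (P : C * C) : in_polydisc g P -> in_polydisc h P ->
  germ_eval (g * h) P = germ_eval g P * germ_eval h P.
Proof.
move=> /in_polydisc_dom[r1 [s1 [A [r10 Pr1 Ps1 gA]]]].
move=> /in_polydisc_dom[r2 [s2 [B [r20 Pr2 Ps2 hB]]]].
pose r := Num.min r1 r2; pose s := Num.min s1 s2.
have r0 : 0 < r by rewrite lt_min r10.
have Pr : nc P.1 <= r by rewrite le_min Pr1.
have Ps : nc P.2 <= s by rewrite le_min Ps1.
have s0 := le_trans (nc_ge0 _) Ps.
have {}gA : dom r s A g by apply: dom_le gA; rewrite ?(ltW r0) ?ge_min ?lexx.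
have {}hB : dom r s B h by apply: dom_le hB; rewrite ?(ltW r0) ?ge_min ?lexx ?orbT.
have E : germ_val (g * h) = germ_val g * germ_val h by exact: (rmorphM val).
rewrite !germ_evalE E (ev_innerM r0 Ps gA hB).
exact: (evM Pr (wnorm_ev_inner r0 Ps gA) (wnorm_ev_inner r0 Ps hB)).
Qed.

(** The choice made by [xget] may rest on another fraction c / d. Cross-multiplying and evaluating
    at P, where evaluation is multiplicative, gives the same value. *)
Lemma frac_eval_tofrac (a b : germ R) (P : C * C) :
  in_polydisc a P -> in_polydisc b P -> germ_eval b P != 0 ->
  frac_eval (FracField.tofrac a / FracField.tofrac b) P = germ_eval a P / germ_eval b P.
Proof.
move=> aP bP b0; rewrite /frac_eval.
have nz (g : germ R) : germ_eval g P != 0 -> g != 0.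
  apply: contraNneq => ->; rewrite germ_evalE /ev (@csum_fin _ 0) ?big_ord0 // => k _ /=.
  by rewrite /ev (@csum_fin _ 0) ?big_ord0 ?mul0r // => j _; rewrite mul0r.
case: xgetP => [v _ /=|/(_ (germ_eval a P / germ_eval b P)) /=]; last first.
  by case; exists a, b.
case=> c [d [E [cP dP] d0 ->]].
have /eqP : FracField.tofrac (a * d) = FracField.tofrac (c * b).
  rewrite !rmorphM /=; apply/eqP; rewrite -eqr_div ?E // tofrac_eq0; exact: nz.
rewrite tofrac_eq => /eqP/(congr1 (fun g => germ_eval g P)).
by rewrite !germ_evalM // => h; apply/eqP; rewrite eqr_div // h.
Qed.

(** Isolated zeros: dividing by the lowest power present leaves a series d with nonzero constant
    term, which by continuity does not vanish near 0; a small positive real s works. *)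
Lemma ev_neq0 (c : fps C) (r M e : R) : 0 < r -> (forall n, wnorm nc r n c <= M) ->
  c != 0 -> 0 < e -> exists2 s : C, nc s < e & ev s c != 0.
Proof.
move=> r0 cM /fps_neq0P[m [cm c0]] e0.
pose d : fps C := Fps (fun n => fcoef c (m + n)%N).
have dM n : wnorm nc r n d <= M / r ^+ m.
  rewrite ler_pdivlMr ?exprn_gt0 //; apply: le_trans (cM (m + n)%N).
  rewrite /wnorm big_split_ord /= mulr_suml -[leLHS]add0r lerD //.
    by apply: sumr_ge0 => k _; rewrite mulr_ge0 ?nc_ge0 ?exprn_ge0 ?(ltW r0).
  by apply: ler_sum => k _; rewrite -mulrA -exprD addnC.
have h := @ev_is_derive _ _ _ _ 0 0 dM.
rewrite subr0 nc0 in h; have {}h := is_derive_near_ne0 (h r0).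
rewrite subr0 ev0 /= addn0 in h; have {h} /near_ncP[e' e'0 he'] := h cm.
pose q := Num.min e (Num.min e' r); have q0 : 0 < q by rewrite !lt_min e0 e'0.
have [qe [qe' qr]] : q <= e /\ q <= e' /\ q <= r.
  by rewrite /q !ge_min !lexx !orbT.
have q2 : 0 < q / 2 by rewrite divr_gt0.
have ns : nc (q / 2)%:C%C = q / 2 by rewrite nc_real // ltW.
exists (q / 2)%:C%C; first by rewrite ns; lra.
have sr : nc (q / 2)%:C%C <= r by rewrite ns; lra.
have := he' (q / 2)%:C%C; rewrite !subr0 ns => h.
have -> : ev (q / 2)%:C%C c = (q / 2)%:C%C ^+ m * ev (q / 2)%:C%C d.
  rewrite /ev (csum_split m (wnorm_asum sr cM)) big1 ?add0r => [|k _]; last by rewrite c0 ?mul0r.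
  rewrite -(csumZ _ (wnorm_asum sr dM)); apply: eq_csum => k /=.
  by rewrite exprD mulrCA.
rewrite mulf_neq0 ?expf_neq0 //; first by rewrite -nc_gt0 ns.
apply: h; lra.
Qed.

(** One variable at a time: a nonzero row of g provides u for which the series in x is nonzero, and
    this series then provides x. *)
Lemma germ_eval_neq0 (g : germ R) (e : R) : g != 0 -> 0 < e ->
  exists P : C * C, [/\ nc P.1 < e, nc P.2 < e & germ_eval g P != 0].
Proof.
move=> g0 e0; have [t [A [t0 gA]]] := germ_dom g.
have /fps_neq0P[i [gi _]] : val g != 0 by apply: contraNneq g0 => h; apply/eqP/val_inj.
pose e' := Num.min e t; have e'0 : 0 < e' by rewrite lt_min e0.
have [u ue' u0] := ev_neq0 t0 (fun m => dom_row i m t0 (ltW t0) gA) gi e'0.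
move: ue'; rewrite lt_min => /andP[ue ut].
have nz : ev_inner u g != 0 by apply: contraNneq u0 => /fpsP/(_ i) /= ->.
have [x xe x0] := ev_neq0 t0 (wnorm_ev_inner t0 (ltW ut) gA) nz e0.
by exists (x, u).
Qed.

(* With [Y i j := X ^+ i * U ^+ j] this substitutes [X], [U] for the variables of *)
(* [a]; it expands [a] along a curve without recentring its Taylor series at 0.  *)
Definition comb a (Y : nat -> nat -> fps C) : fps C :=
  Fps (fun n => csum (fun i => csum (fun j => coef2 a i j * fcoef (Y i j) n))).

Definition subst_germ a (X U : fps C) : fps C := comb a (fun i j => X ^+ i * U ^+ j).

Section Comb.
Variables (t r k A : R) (a : fps (fps C)) (Y : nat -> nat -> fps C).
Hypotheses (r0 : 0 < r) (k0 : 0 <= k) (aA : dom t t A a).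
(** The factor k is 1 for the monomials of a substitution and small for differences of two such
    monomials; the latter makes substitution Lipschitz. *)
Hypothesis Yk : forall i j n, wnorm nc r n (Y i j) <= k * (t ^+ i * t ^+ j).

(** With the weight [r ^+ n], all finite sums of the triple family have the bound k * A. The sums
    over j and i are then completed one after the other by [sum_nc_csum]. *)
Let F n i j := coef2 a i j * fcoef (Y i j) n * (r ^+ n)%:C%C.

Let FP n I J : \sum_(l < n) \sum_(i < I) \sum_(j < J) nc (F l i j) <= k * A.
Proof.
rewrite exchange_big; under eq_bigr do rewrite exchange_big.
apply: le_trans (ler_wpM2l k0 (aA I J)); rewrite dnormE mulr_sumr.
apply: ler_sum => i _; rewrite mulr_sumr; apply: ler_sum => j _.
apply: le_trans (_ : nc (coef2 a i j) * wnorm nc r n (Y i j) <= _).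
  rewrite mulr_sumr; apply: ler_sum => l _.
  by rewrite /F !ncM (nc_real (exprn_ge0 _ (ltW r0))) mulrA.
apply: le_trans (ler_wpM2l (nc_ge0 _) (Yk i j n)) _.
by rewrite le_eqVlt; apply/orP; left; apply/eqP; ring.
Qed.

Let FP1 n I : \sum_(l < n) \sum_(i < I) nc (csum (F l i)) <= k * A.
Proof.
rewrite (pair_big xpredT xpredT (fun (l : 'I_n) (i : 'I_I) => nc (csum (F l i)))) /=.
apply: (sum_nc_csum (f := fun p : 'I_n * 'I_I => F p.1 p.2)) => J.
rewrite -(pair_big xpredT xpredT (fun (l : 'I_n) (i : 'I_I) => \sum_(j < J) nc (F l i j))) /=.
exact: FP.
Qed.

Let FP2 n : \sum_(l < n) nc (csum (fun i => csum (F l i))) <= k * A.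
Proof. by apply: (sum_nc_csum (f := fun (l : 'I_n) i => csum (F l i))) => I; exact: FP1. Qed.

Let G n i j := coef2 a i j * fcoef (Y i j) n.

Let GP n I J : \sum_(i < I) \sum_(j < J) nc (G n i j) <= k * A / r ^+ n.
Proof.
rewrite ler_pdivlMr ?exprn_gt0 //; apply: le_trans (FP n.+1 I J).
rewrite [leRHS]big_ord_recr /= -[leLHS]add0r; apply: lerD.
  by do 3! (apply: sumr_ge0 => ? _); exact: nc_ge0.
rewrite mulr_suml; apply: ler_sum => i _; rewrite mulr_suml; apply: ler_sum => j _.
by rewrite /F -/(G n i j) ncM nc_real // exprn_ge0 // ltW.
Qed.

Lemma comb_inner_asum n i : asum (k * A / r ^+ n) (G n i).
Proof.
move=> J; apply: le_trans (GP n i.+1 J); rewrite [leRHS]big_ord_recr /= lerDr.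
by do 2! (apply: sumr_ge0 => ? _); exact: nc_ge0.
Qed.

Lemma comb_outer_asum n : asum (k * A / r ^+ n) (fun i => csum (G n i)).
Proof. by move=> I; apply: (sum_nc_csum (f := fun i : 'I_I => G n i)) => J; exact: GP. Qed.

Let scale n c : csum (fun i => csum (fun j => G n i j * c)) = fcoef (comb a Y) n * c.
Proof.
rewrite [RHS]mulrC -(csumZ _ (comb_outer_asum n)); apply: eq_csum => i.
by rewrite -(csumZ _ (comb_inner_asum n i)); apply: eq_csum => j; rewrite mulrC.
Qed.

Lemma wnorm_comb n : wnorm nc r n (comb a Y) <= k * A.
Proof.
apply: le_trans (FP2 n); apply: ler_sum => l _.
by rewrite scale ncM (nc_real (exprn_ge0 _ (ltW r0))).
Qed.

Lemma ev_comb s : nc s <= r ->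
  ev s (comb a Y) = csum (fun i => csum (fun j => coef2 a i j * ev s (Y i j))).
Proof.
move=> sr; pose H n i j := G n i j * s ^+ n.
have HF n i j : nc (H n i j) <= nc (F n i j).
  rewrite /H /F -/(G n i j) ncM [leRHS]ncM ler_wpM2l ?nc_ge0 // ncX nc_real ?exprn_ge0 ?(ltW r0) //.
  by rewrite lerXn2r ?nnegrE ?nc_ge0 // ltW.
have HP n I J : \sum_(l < n) \sum_(i < I) \sum_(j < J) nc (H l i j) <= k * A.
  by apply: le_trans (FP n I J); do 3! (apply: ler_sum => ? _); exact: HF.
rewrite /ev; under eq_csum do rewrite -scale.
rewrite (@csum_exchange _ (k * A)); last first.
  move=> n I.
  rewrite (pair_big xpredT xpredT (fun (l : 'I_n) (i : 'I_I) => nc (csum (H l i)))) /=.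
  apply: (sum_nc_csum (f := fun p : 'I_n * 'I_I => H p.1 p.2)) => J.
  rewrite -(pair_big xpredT xpredT (fun (l : 'I_n) (i : 'I_I) => \sum_(j < J) nc (H l i j))) /=.
  exact: HP.
apply: eq_csum => i; rewrite (@csum_exchange _ (k * A)); last first.
  move=> n J; apply: le_trans (HP n i.+1 J); apply: ler_sum => l _.
  rewrite [leRHS]big_ord_recr /= lerDr.
  by do 2! (apply: sumr_ge0 => ? _); exact: nc_ge0.
apply: eq_csum => j; rewrite -(csumZ _ (wnorm_asum sr (Yk i j))).
by apply: eq_csum => n; rewrite /H /G mulrA.
Qed.

End Comb.

Lemma combB (t r k l A : R) a (Y Z : nat -> nat -> fps C) :
  0 < r -> 0 <= k -> 0 <= l -> dom t t A a ->
  (forall i j n, wnorm nc r n (Y i j) <= k * (t ^+ i * t ^+ j)) ->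
  (forall i j n, wnorm nc r n (Z i j) <= l * (t ^+ i * t ^+ j)) ->
  comb a (fun i j => Y i j - Z i j) = comb a Y - comb a Z.
Proof.
move=> r0 k0 l0 aA Yk Zl; apply/fpsP => n; rewrite fcoefD fcoefN /=.
have y1 i := comb_inner_asum r0 k0 aA Yk n i.
have z1 i := asumZ (-1) (comb_inner_asum r0 l0 aA Zl n i).
have y2 := comb_outer_asum r0 k0 aA Yk n.
have z2 := asumZ (-1) (comb_outer_asum r0 l0 aA Zl n).
rewrite -mulN1r -(csumZ _ (comb_outer_asum r0 l0 aA Zl n)) -(csumD y2 z2).
apply: eq_csum => i; rewrite -(csumZ _ (comb_inner_asum r0 l0 aA Zl n i)) -(csumD (y1 i) (z1 i)).
by apply: eq_csum => j; rewrite mulrDr mulN1r mulrN.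
Qed.

Lemma comb_eq n a (Y Z : nat -> nat -> fps C) :
  (forall i j, fcoef (Y i j) n = fcoef (Z i j) n) -> fcoef (comb a Y) n = fcoef (comb a Z) n.
Proof. by move=> YZ; apply: eq_csum => i; apply: eq_csum => j; rewrite YZ. Qed.

End GermEvaluation.

(** * Formal solutions of differential equations *)

Section FormalFixpoint.
Variables (E I T : Type) (co : E -> I -> T) (mk : (I -> T) -> E) (lev : I -> nat).
Hypotheses (mkK : forall f i, co (mk f) i = f i)
  (co_inj : forall v w, (forall i, co v i = co w i) -> v = w).

Definition agree n (v w : E) : Prop := forall i, (lev i < n)%N -> co v i = co w i.

(** Iterate n is already stable below level n, so each coefficient i of the fixed point is read off
    the iterate [(lev i).+1]. Bounds on truncated norms qualify as Q, since they only see finitely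
    many coefficients. *)
Lemma formal_fixpoint (Phi : E -> E) (Q : E -> Prop) (v0 : E) : Q v0 ->
  (forall v, Q v -> Q (Phi v)) ->
  (forall n v w, Q v -> Q w -> agree n v w -> agree n.+1 (Phi v) (Phi w)) ->
  (forall v, (forall n, exists2 w, Q w & agree n v w) -> Q v) ->
  exists2 v, Q v & Phi v = v.
Proof.
move=> Q0 QP PhiC Qcl; pose s n := iter n Phi v0.
have Qs n : Q (s n) by elim: n => [//|n IH]; exact: QP.
have step n : agree n (s n) (s n.+1) by elim: n => [i //|n IH]; exact: PhiC (Qs n) (Qs n.+1) IH.
have stab n m : agree n (s n) (s (n + m)%N).
  elim: m => [|m IH] i lin; first by rewrite addn0.
  by rewrite IH // addnS; exact: (step _ i (leq_trans lin (leq_addr _ _))).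
pose v := mk (fun i => co (s (lev i).+1) i).
have vs n : agree n v (s n).
  by move=> i lin; rewrite mkK -(subnKC lin); exact: stab.
have Qv : Q v by apply: Qcl => n; exists (s n).
exists v => //; apply: co_inj => i.
have h : agree (lev i).+1 (Phi v) (s (lev i).+1) by exact: PhiC.
by rewrite h // -vs.
Qed.

End FormalFixpoint.

Section ODE.
Variable R : realType.
Local Notation C := R[i].
Local Notation nc := (@Normc.normc R).
Local Notation ncS := (nc_seminorm R).
Implicit Types (a b X U V : fps C) (g : germ R).

Lemma fpsCM (K : comNzRingType) (x y : K) : fpsC (x * y) = fpsC x * fpsC y.
Proof. by apply/fpsP => -[|n]; rewrite fcoefCM //= mulr0. Qed.

Lemma fpsC1 (K : comNzRingType) : fpsC (1 : K) = 1.
Proof. by apply/fpsP => -[|n]. Qed.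

Lemma fpsCX (K : comNzRingType) (x : K) n : fpsC (x ^+ n) = fpsC x ^+ n.
Proof. by elim: n => [|n IH]; rewrite ?expr0 ?fpsC1 // !exprS fpsCM IH. Qed.

Definition eqlow n (v w : fps C) : Prop := agree (@fcoef C) id n v w.

Lemma eqlowD n a b a' b' : eqlow n a a' -> eqlow n b b' -> eqlow n (a + b) (a' + b').
Proof. by move=> aa bb i lin; rewrite !fcoefD aa // bb. Qed.

Lemma eqlowN n a a' : eqlow n a a' -> eqlow n (- a) (- a').
Proof. by move=> aa i lin; rewrite !fcoefN aa. Qed.

Lemma eqlowM n a b a' b' : eqlow n a a' -> eqlow n b b' -> eqlow n (a * b) (a' * b').
Proof.
move=> aa bb i lin; rewrite !fcoefM; apply: eq_bigr => k _.
by rewrite aa ?bb //= ?(leq_ltn_trans (leq_subr _ _)) // (leq_ltn_trans (leq_ord k)).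
Qed.

(** The coefficient of index n of [a], which is not controlled, only meets the vanishing constant
    term of [b]. *)
Lemma eqlowM0 n a b a' b' : eqlow n a a' -> eqlow n.+1 b b' -> fcoef b 0 = 0 ->
  eqlow n.+1 (a * b) (a' * b').
Proof.
move=> aa bb b0 i lin; rewrite !fcoefM; apply: eq_bigr => k _.
have [kn|nk] := ltnP k n.
  by rewrite aa // bb //= (leq_ltn_trans (leq_subr _ _)).
have -> : (i - k = 0)%N by move: lin nk => /=; lia.
by rewrite -(bb 0%N) // b0 !mulr0.
Qed.

Lemma eqlowX n a a' m : eqlow n a a' -> eqlow n (a ^+ m) (a' ^+ m).
Proof.
move=> aa; elim: m => [|m IH]; first by rewrite !expr0 => i.
by rewrite !exprS; exact: eqlowM aa IH.
Qed.

Lemma eqlow_sum n d (F G : nat -> fps C) : (forall j, eqlow n (F j) (G j)) ->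
  eqlow n (\sum_(j < d) F j) (\sum_(j < d) G j).
Proof. by move=> h i lin; rewrite !fcoef_sum; apply: eq_bigr => j _; exact: h. Qed.

Lemma eqlow_subst_germ n (g : fps (fps C)) X U X' U' : eqlow n X X' -> eqlow n U U' ->
  eqlow n (subst_germ g X U) (subst_germ g X' U').
Proof.
by move=> XX UU i lin; apply: comb_eq => k l; exact: (eqlowM (eqlowX k XX) (eqlowX l UU)).
Qed.

(** * Estimates for substitution and integration *)

Lemma wnorm_subst_term (r t : R) X U : 0 <= r ->
  (forall n, wnorm nc r n X <= t) -> (forall n, wnorm nc r n U <= t) ->
  forall i j n, wnorm nc r n (X ^+ i * U ^+ j) <= 1 * (t ^+ i * t ^+ j).
Proof.
move=> r0 Xt Ut i j n; rewrite mul1r.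
have S := wnorm_seminorm ncS n r0.
exact: (semiM_le S (semiX_le S _ (Xt n)) (semiX_le S _ (Ut n))).
Qed.

Lemma ev_subst_germ (r t A : R) g X U s : 0 < r -> 0 < t -> dom t t A g ->
  (forall n, wnorm nc r n X <= t) -> (forall n, wnorm nc r n U <= t) -> nc s <= r ->
  ev s (subst_germ g X U) = germ_eval g (ev s X, ev s U).
Proof.
move=> r0 t0 gA Xt Ut sr; have r0' := ltW r0.
rewrite /subst_germ (ev_comb r0 ler01 gA (wnorm_subst_term r0' Xt Ut) sr).
rewrite germ_evalE /=; apply: eq_csum => i.
have Ust := le_trans (ev_le sr Ut) (lexx t).
rewrite /= mulrC /ev -(csumZ _ (wnorm_asum Ust (fun m => dom_row i m t0 (ltW t0) gA))).
apply: eq_csum => j; rewrite -/(ev s _).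
have SX n := wnorm_seminorm ncS n r0'.
rewrite (evM sr (fun n => semiX_le (SX n) i (Xt n)) (fun n => semiX_le (SX n) j (Ut n))).
by rewrite (evX sr i Xt) (evX sr j Ut) -/(ev s X) -/(ev s U) mulrCA.
Qed.

Lemma subst_germ_fpsC (t A : R) g (x u : C) : 0 < t -> dom t t A g -> nc x <= t -> nc u <= t ->
  subst_germ g (fpsC x) (fpsC u) = fpsC (germ_eval g (x, u)).
Proof.
move=> t0 gA xt ut; have wC (z : C) : nc z <= t -> forall n, wnorm nc 1 n (fpsC z) <= t.
  by move=> zt n; apply: le_trans (wnormC _ _ _ ncS) zt.
apply/fpsP => -[|n].
  have := ev_subst_germ ltr01 t0 gA (wC x xt) (wC u ut) (s := 0).
  by rewrite !ev0 nc0; exact.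
have E i j : fcoef (fpsC x ^+ i * fpsC u ^+ j) n.+1 = 0 by rewrite -!fpsCX -fpsCM.
transitivity (csum (fun i => csum (fun j => coef2 g i j * 0))).
  by apply: eq_csum => i; apply: eq_csum => j; rewrite E.
by do 2! (rewrite (@csum_fin _ 0) ?big_ord0 // => ? _); rewrite mulr0.
Qed.

(** Here tau is the room left inside the polydisc of radius t. Splitting off one factor, [Z * W - z
    * w = (Z - z) * W + z * (W - w)] costs [s * M + nu z * (s / tau * M)], which is
    [s / tau * ((nu z + tau) * M)] and hence at most [s / tau * (t * M)]. *)
Lemma seminorm_pow_dist (K : comNzRingType) (nu : K -> R) (x u X U : K) (s tau t : R) :
  seminorm nu -> 0 <= s -> 0 < tau -> s <= tau ->
  nu x + tau <= t -> nu u + tau <= t -> nu (X - x) <= s -> nu (U - u) <= s ->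
  forall i j, nu (X ^+ i * U ^+ j - x ^+ i * u ^+ j) <= s / tau * (t ^+ i * t ^+ j).
Proof.
move=> S s0 tau0 st xt ut Xx Uu.
have step (z Z W w : K) M : nu z + tau <= t -> nu (Z - z) <= s ->
    nu W <= M -> nu (W - w) <= s / tau * M -> nu (Z * W - z * w) <= s / tau * (t * M).
  move=> zt Zz WM Ww.
  have M0 : 0 <= M := le_trans (semi_ge0 S _) WM.
  have -> : Z * W - z * w = (Z - z) * W + z * (W - w) by ring.
  apply: le_trans (semiD_le S (semiM_le S Zz WM) (semiM_le S (lexx _) Ww)) _.
  apply: le_trans (_ : s / tau * ((nu z + tau) * M) <= _); last first.
    by apply: ler_wpM2l; rewrite ?divr_ge0 ?(ltW tau0) // ler_wpM2r.
  have sE : s = s / tau * tau by rewrite divfK ?gt_eqF.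
  rewrite {1}sE le_eqVlt; apply/orP; left; apply/eqP; ring.
have bnd (z Z : K) : nu z + tau <= t -> nu (Z - z) <= s -> nu Z <= t.
  move=> zt Zz; rewrite -[Z](subrK z).
  apply: le_trans (semiD_le S Zz (lexx _)) _; lra.
have Xt := bnd _ _ xt Xx; have Ut := bnd _ _ ut Uu.
elim=> [|i IH] j; last first.
  rewrite !exprS -(mulrA X) -(mulrA x) -(mulrA t).
  exact: (step x X _ _ _ xt Xx (semiM_le S (semiX_le S i Xt) (semiX_le S j Ut)) (IH j)).
rewrite !expr0 !mul1r; elim: j => [|j IH].
  by rewrite !expr0 subrr (semi0 S) mulr1 divr_ge0 // ltW.
rewrite !exprS; exact: (step u U _ _ _ ut Uu (semiX_le S j Ut) IH).
Qed.

Definition integ (c : C) V : fps C :=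
  Fps (fun n => if n is m.+1 then fcoef V m / m.+1%:R else c).

Lemma fderiv_integ c V : fderiv (integ c V) = V.
Proof.
by apply/fpsP => n /=; rewrite mulrC divfK // pnatr_eq0.
Qed.

(** Integration gains a factor r, the source of all smallness in the existence proof. *)
Lemma wnorm_integ (r M : R) c V : 0 <= r -> (forall n, wnorm nc r n V <= M) ->
  forall n, wnorm nc r n (integ c V - fpsC c) <= r * M.
Proof.
move=> r0 VM [|n].
  by rewrite /wnorm big_ord0 mulr_ge0 //; apply: le_trans (VM 0%N); rewrite /wnorm big_ord0.
rewrite /wnorm big_ord_recl fcoefD fcoefN /= subrr nc0 mul0r add0r.
apply: le_trans (ler_wpM2l r0 (VM n)); rewrite mulr_sumr; apply: ler_sum => k _.
rewrite /= subr0 ncM ncV nc_nat exprS mulrCA ler_wpM2l //.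
rewrite ler_wpM2r ?exprn_ge0 // ler_piMr ?nc_ge0 //.
by rewrite invf_le1 ?ltr0n // ler1n.
Qed.

Lemma eqlow_integ n c V V' : eqlow n V V' -> eqlow n.+1 (integ c V) (integ c V').
Proof. by move=> VV [|i] //= lin; rewrite VV. Qed.

Lemma exists_small (c d : R) : 0 <= c -> 0 < d ->
  exists2 r0, 0 < r0 & forall r, 0 < r -> r <= r0 -> r * c <= d.
Proof.
move=> c0 d0; have c1 : 0 < c + 1 by lra.
exists (d / (c + 1)); first by rewrite divr_gt0.
move=> r r0; rewrite ler_pdivlMr // mulrDr mulr1 => h; lra.
Qed.

(** [integ x0 1] is x0 plus the local parameter, that is, the coordinate x along the curve. The
    final equation is the differential equation multiplied by b, free of denominators. *)
Lemma ode_formal_solution (t A : R) (a : nat -> germ R) (b : germ R) d (x0 u0 p : C) :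
  0 < t -> (forall j, (j < d)%N -> dom t t A (a j)) -> dom t t A b ->
  nc x0 < t -> nc u0 < t -> germ_eval b (x0, u0) != 0 ->
  exists (V : fps C) (r M : R),
  let U1 := integ p V in let U := integ u0 U1 in let X := integ x0 1 in
  [/\ 0 < r, forall n, wnorm nc r n X <= t, forall n, wnorm nc r n U <= t,
      (forall n, wnorm nc r n U1 <= M) /\ (forall n, wnorm nc r n V <= M)
    & V * subst_germ b X U = \sum_(j < d) subst_germ (a j) X U * U1 ^+ j].
Proof.
move=> t0 aA bA xt ut b0; set be := germ_eval b (x0, u0) in b0.
have A0 := dom_ge0 bA; have nb : 0 < nc be by rewrite nc_gt0.
have nx := nc_ge0 x0; have nu := nc_ge0 u0; have np := nc_ge0 p.
pose tau := t - Num.max (nc x0) (nc u0).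
have tau0 : 0 < tau by rewrite subr_gt0 gt_max xt.
have [xtau utau] : nc x0 + tau <= t /\ nc u0 + tau <= t.
  have : nc x0 <= Num.max (nc x0) (nc u0) by rewrite le_max lexx.
  have : nc u0 <= Num.max (nc x0) (nc u0) by rewrite le_max lexx orbT.
  by rewrite /tau; split; lra.
pose pp := nc p + 1; have pp0 : 0 < pp by rewrite /pp; lra.
pose S0 := \sum_(j < d) pp ^+ j.
have S00 : 0 <= S0 by apply: sumr_ge0 => j _; rewrite exprn_ge0 // ltW.
(* K makes the ball of radius K stable: before division by [nc be], the numerator contributes A *
   S0, which is half of [nc be * K], and the term V (b - be) at most the other half. *)
pose K := 2 * (A * S0) / nc be.
have K0 : 0 <= K by rewrite divr_ge0 ?(ltW nb) // !mulr_ge0.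
have KE : A * S0 = nc be * K / 2 by rewrite /K; field; rewrite gt_eqF.
(* Three conditions on the radius: U' stays within 1 of p, hence below pp; X and U stay within tau
   of x0 and u0; and b(X, U) stays within [nc be / 2] of its value at P. *)
have [r1 r10 hr1] := exists_small K0 ltr01.
have [r2 r20 hr2] := exists_small (ltW pp0) tau0.
have d3 : 0 < nc be * tau / 2 by rewrite divr_gt0 ?mulr_gt0.
have [r3 r30 hr3] := exists_small (mulr_ge0 (ltW pp0) A0) d3.
pose r := Num.min r1 (Num.min r2 r3).
have r0 : 0 < r by rewrite !lt_min r10 r20.
have {}hr1 : r * K <= 1 by apply: hr1 => //; rewrite !ge_min lexx.
have {}hr2 : r * pp <= tau by apply: hr2 => //; rewrite !ge_min lexx orbT.
have {}hr3 : r * (pp * A) <= nc be * tau / 2 by apply: hr3 => //; rewrite !ge_min lexx !orbT.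
have r0' := ltW r0; have S n := wnorm_seminorm ncS n r0'.
have wC n (c : C) : wnorm nc r n (fpsC c) <= nc c := wnormC r n c ncS.
pose X : fps C := integ x0 1.
pose U1 V := integ p V; pose U V := integ u0 (U1 V).
pose Phi V := fpsC be^-1 * (\sum_(j < d) subst_germ (a j) X (U V) * U1 V ^+ j
   - V * (subst_germ b X (U V) - fpsC be)).
pose Q V := forall n, wnorm nc r n V <= K.
have dX n : wnorm nc r n (X - fpsC x0) <= r * pp.
  apply: le_trans (_ : r * 1 <= _); last by rewrite ler_wpM2l // /pp; lra.
  by apply: wnorm_integ => // m; exact: semi1.
have bU1 V : Q V -> forall n, wnorm nc r n (U1 V) <= pp.
  move=> QV n; rewrite -[U1 V](subrK (fpsC p)).
  apply: le_trans (semiD_le (S n) (wnorm_integ p r0' QV n) (wC n p)) _.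
  by rewrite /pp addrC lerD2l.
have dU V : Q V -> forall n, wnorm nc r n (U V - fpsC u0) <= r * pp.
  by move=> QV n; apply: wnorm_integ => //; exact: bU1.
have bnd (z : C) Z : nc z + tau <= t -> (forall n, wnorm nc r n (Z - fpsC z) <= r * pp) ->
    forall n, wnorm nc r n Z <= t.
  move=> zt Zz n; rewrite -[Z](subrK (fpsC z)).
  apply: le_trans (semiD_le (S n) (Zz n) (wC n z)) _; lra.
have bX := bnd _ _ xtau dX.
have bU V (QV : Q V) := bnd _ _ utau (dU V QV).
have rpp0 : 0 <= r * pp by rewrite mulr_ge0 // ltW.
have subC : subst_germ b (fpsC x0) (fpsC u0) = fpsC be by exact: subst_germ_fpsC t0 bA (ltW xt) (ltW ut).
have dsub V : Q V -> forall n, wnorm nc r n (subst_germ b X (U V) - fpsC be) <= nc be / 2.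
  move=> QV n.
  have wx : forall n, wnorm nc r n (fpsC x0) <= t by move=> m; apply: le_trans (wC m x0) (ltW xt).
  have wu : forall n, wnorm nc r n (fpsC u0) <= t by move=> m; apply: le_trans (wC m u0) (ltW ut).
  rewrite -subC /subst_germ -(combB r0 ler01 ler01 bA (wnorm_subst_term r0' bX (bU V QV))
    (wnorm_subst_term r0' wx wu)).
  apply: le_trans (_ : r * pp / tau * A <= _); last first.
    by rewrite mulrAC ler_pdivrMr // -mulrA mulrAC.
  apply: (wnorm_comb r0 _ bA); first by rewrite divr_ge0 // ltW.
  move=> i j m.
  have xm := le_trans (lerD (wC m x0) (lexx tau)) xtau.
  have um := le_trans (lerD (wC m u0) (lexx tau)) utau.
  exact: (seminorm_pow_dist (S m) rpp0 tau0 hr2 xm um (dX m) (dU V QV m)).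
have asub V : Q V -> forall j n, (j < d)%N -> wnorm nc r n (subst_germ (a j) X (U V)) <= A.
  move=> QV j n jd; rewrite -[leRHS]mul1r.
  exact: (wnorm_comb r0 ler01 (aA j jd) (wnorm_subst_term r0' bX (bU V QV))).
have [] := @formal_fixpoint (fps C) nat C (@fcoef C) (@Fps C) id _ _ Phi Q 0.
- by [].
- by move=> v w h; apply/fpsP.
- by move=> n; rewrite (semi0 (S n)).
- move=> V QV n.
  apply: le_trans (semiM_le (S n) (wC n _) (lexx _)) _; rewrite ncV.
  rewrite mulrC ler_pdivrMr //.
  apply: le_trans (_ : A * S0 + K * (nc be / 2) <= _); last by rewrite KE; lra.
  apply: semiD_le => //; last first.
    by rewrite semiN //; apply: semiM_le => //; exact: dsub.
  apply: le_trans (semi_sum (S n) _ _ _) _; rewrite mulr_sumr; apply: ler_sum => j _.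
  apply: semiM_le => //; first exact: asub.
  by apply: semiX_le => //; exact: bU1.
- move=> n V V' QV QV' VV.
  (* Integration gains the order in every term except V (b - be), where the second factor gains it
     by having no constant term. *)
  have e1 : eqlow n.+1 (U1 V) (U1 V') := eqlow_integ p VV.
  have e2 : eqlow n.+1 (U V) (U V').
    by move=> i lin; apply: (eqlow_integ u0 e1); exact: leqW.
  have e3 g : eqlow n.+1 (subst_germ g X (U V)) (subst_germ g X (U V')) by exact: eqlow_subst_germ.
  apply: (eqlowM (a := fpsC be^-1)) => [i //|]; apply: eqlowD.
    exact: (eqlow_sum d (fun j => eqlowM (e3 (a j)) (eqlowX j e1))).
  apply: eqlowN; apply: (eqlowM0 VV); first exact: (eqlowD (e3 b) (fun i _ => erefl)).
  rewrite fcoefD fcoefN -subC; apply/eqP; rewrite subr_eq0; apply/eqP.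
  by apply: (@eqlow_subst_germ 1) => // -[].
- move=> V h n; have [W QW VW] := h n; apply: le_trans (QW n).
  by apply: ler_sum => k _; rewrite VW.
move=> V QV PhiV; exists V, r, (Num.max pp K); split=> //.
- exact: bU.
- split=> n; rewrite le_max; first by rewrite bU1.
  by rewrite QV orbT.
have : fpsC be * Phi V = fpsC be * V by rewrite PhiV.
rewrite mulrA -fpsCM mulfV // fpsC1 mul1r => /eqP.
rewrite subr_eq -/X -/(U1 V) -/(U V) => /eqP ->; ring.
Qed.

End ODE.

(** * Simple roots over the ring of germs *)

Section Hensel.
Variable R : realType.
Local Notation C := R[i].
Local Notation nc := (@Normc.normc R).
Local Notation ncS := (nc_seminorm R).
Local Notation S2 := (fps (fps C)).

(** The n-th power of the maximal ideal (x, u) of the formal power series. *)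
Definition vanishing n (v : S2) : Prop := forall i j, (i + j < n)%N -> coef2 v i j = 0.

Lemma coef2D (v w : S2) i j : coef2 (v + w) i j = coef2 v i j + coef2 w i j.
Proof. by rewrite /coef2 !fcoefD. Qed.

Lemma coef2N (v : S2) i j : coef2 (- v) i j = - coef2 v i j.
Proof. by rewrite /coef2 !fcoefN. Qed.

Lemma vanishingD n v w : vanishing n v -> vanishing n w -> vanishing n (v + w).
Proof. by move=> vn wn i j ij; rewrite coef2D vn // wn // addr0. Qed.

Lemma vanishingM n m v w : vanishing n v -> vanishing m w -> vanishing (n + m) (v * w).
Proof.
move=> vn wm i j ij; rewrite coef2M big1 // => k _; rewrite big1 // => l _.
have [kl|kl] := ltnP (k + l) n; first by rewrite vn // mul0r.
rewrite wm ?mulr0 //; have := ltn_ord k; have := ltn_ord l; lia.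
Qed.

Lemma vanishing0 v : vanishing 0 v. Proof. by []. Qed.

Definition cst2 (c : C) : S2 := fpsC (fpsC c).

Lemma coef2_cst2 c : coef2 (cst2 c) 0 0 = c. Proof. by []. Qed.

Lemma cst2M c d : cst2 (c * d) = cst2 c * cst2 d.
Proof. by rewrite /cst2 !fpsCM. Qed.

Lemma cst2_1 : cst2 1 = 1.
Proof. by rewrite /cst2 !fpsC1. Qed.

Lemma dnorm_cst2 (r s : R) n m c : 0 <= r -> 0 <= s -> dnorm r s n m (cst2 c) <= nc c.
Proof.
move=> r0 s0; apply: le_trans (wnormC r n _ (wnorm_seminorm ncS m s0)) _.
exact: (wnormC s m c ncS).
Qed.

Lemma dom_convergent (r A : R) (v : S2) : 0 < r -> dom r r A v -> v \in (@convergent2 R).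
Proof.
move=> r0 vA; apply/asboolP; exists r%:C%C; split; first by rewrite ltcR.
exists A%:C%C => i j; rewrite nc_norm -!rmorphXn -!rmorphM lecR mulrAC.
by apply: dom_term => //; exact: ltW.
Qed.

Lemma cst2_convergent c : cst2 c \in (@convergent2 R).
Proof. by apply: (@dom_convergent 1 (nc c)) => // n m; exact: dnorm_cst2. Qed.

Definition germC c : germ R := Germ (cst2_convergent c).

Lemma germ_valM (g h : germ R) : germ_val (g * h) = germ_val g * germ_val h.
Proof. by []. Qed.

(** Reduction modulo the maximal ideal, named in order to be a ring morphism; it is convertible to
    the map used in [simple_slopes]. *)
Definition germ00 (g : germ R) : C := coef2 g 0 0.

Lemma germ00_is_zmod_morphism : zmod_morphism germ00.
Proof. by move=> g h; rewrite /germ00 -coef2N -coef2D. Qed.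

Lemma germ00_is_monoid_morphism : monoid_morphism germ00.
Proof.
split=> [|g h]; first exact: coef2_cst2.
by rewrite /germ00 germ_valM coef2M !big_ord_recl !big_ord0 !addr0.
Qed.

HB.instance Definition _ := GRing.isZmodMorphism.Build (germ R) C
  germ00 germ00_is_zmod_morphism.
HB.instance Definition _ := GRing.isMonoidMorphism.Build (germ R) C
  germ00 germ00_is_monoid_morphism.

(** A Schwarz-type bound: going from radius t to r multiplies a monomial of positive degree by at
    most r / t. *)
Lemma dnorm_vanishing1 (t r A : R) v n m : 0 < r -> r <= t -> dom t t A v -> vanishing 1 v ->
  dnorm r r n m v <= r * (A / t).
Proof.
move=> r0 rt vA v1; have t0 := lt_le_trans r0 rt.
apply: le_trans (_ : r / t * dnorm t t n m v <= _); last first.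
  by rewrite [leRHS]mulrA [leRHS]mulrAC ler_wpM2l ?divr_ge0 ?(ltW r0) ?(ltW t0).
rewrite !dnormE mulr_sumr; apply: ler_sum => i _; rewrite mulr_sumr; apply: ler_sum => j _.
case: (posnP (i + j)) => [/eqP ij|ij].
  by rewrite v1 ?nc0 ?mul0r ?mulr0 // ltnS leqn0.
rewrite -!mulrA -!exprD addnC [leRHS]mulrA [leRHS]mulrCA ler_wpM2l ?nc_ge0 //.
rewrite -(prednK ij) !exprS mulrA divfK ?gt_eqF // ler_wpM2l ?(ltW r0) //.
by rewrite lerXn2r ?nnegrE ?(ltW r0) ?(ltW t0).
Qed.

(* [W] is a fixed point of [W |-> - (c0 + (c1 - c1(0)) W + c2 W^2 + W^3) / c1(0)]. *)
Lemma cubic_small_root (c0 c1 c2 : germ R) :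
  germ00 c0 = 0 -> germ00 c1 != 0 ->
  exists W : germ R, germ00 W = 0 /\ c0 + c1 * W + c2 * W ^+ 2 + W ^+ 3 = 0.
Proof.
move=> c00 c10; pose ga := germ00 c1; have nga : 0 < nc ga by rewrite nc_gt0.
pose d1 : germ R := c1 - germC ga.
have d10 : germ00 d1 = 0 by rewrite rmorphB /= subrr.
have [t0 [A0 [t00 dom0]]] := germ_dom c0.
have [t1 [A1 [t10 dom1]]] := germ_dom d1.
have [t2 [A2 [t20 dom2]]] := germ_dom c2.
pose t := Num.min t0 (Num.min t1 t2).
have tt : 0 < t by rewrite !lt_min t00 t10.
pose A := Num.max A0 (Num.max A1 A2).
have domW (s B : R) v : t <= s -> B <= A -> dom s s B v -> dom t t A v.
  move=> ts BA vB n m; apply: le_trans BA.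
  exact: (dom_le (ltW tt) ts (ltW tt) ts vB).
have {}dom0 : dom t t A c0 by apply: domW dom0; rewrite ?ge_min ?le_max lexx.
have {}dom1 : dom t t A d1 by apply: domW dom1; rewrite ?ge_min ?le_max lexx ?orbT.
have {}dom2 : dom t t A c2 by apply: domW dom2; rewrite ?ge_min ?le_max lexx ?orbT.
have A0' := dom_ge0 dom0; have A1' : 0 < 4 * (A + 1) by lra.
(* After division by [nc ga], the constant term, the linear term and the two higher terms together
   take at most e / 4 each; e <= 1 bounds the cube by the square. The radius r chosen below handles
   c0 and d1, which vanish at the origin. *)
pose e := Num.min 1 (nc ga / (4 * (A + 1))).
have e0 : 0 < e by rewrite lt_min ltr01 divr_gt0.
have e1 : e <= 1 by rewrite ge_min lexx.
have eA : (A + 1) * e <= nc ga / 4.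
  have : e <= nc ga / (4 * (A + 1)) by rewrite ge_min lexx orbT.
  rewrite ler_pdivlMr // => h; rewrite ler_pdivlMr ?ltr0n //.
  by apply: le_trans h; rewrite le_eqVlt; apply/orP; left; apply/eqP; ring.
have At0 : 0 <= A / t by rewrite divr_ge0 // ltW.
have ge0 : 0 < nc ga * e / 4 by rewrite divr_gt0 ?mulr_gt0.
have [r1 r10 hr1] := exists_small At0 ge0.
pose r := Num.min r1 t; have r0 : 0 < r by rewrite lt_min r10.
have rt : r <= t by rewrite ge_min lexx orbT.
have {}hr1 : r * (A / t) <= nc ga * e / 4 by apply: hr1 => //; rewrite ge_min lexx.
have S n m := dnorm_seminorm n m (ltW r0) (ltW r0).
have vanishing1P (g : germ R) : germ00 g = 0 -> vanishing 1 g by move=> g0 [|i] [|j].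
pose Q (W : S2) := vanishing 1 W /\ dom r r e W.
pose Phi (W : S2) : S2 := cst2 (- ga^-1) *
  (germ_val c0 + germ_val d1 * W + germ_val c2 * W ^+ 2 + W ^+ 3).
have [] := @formal_fixpoint S2 (nat * nat)%type C (fun v p => coef2 v p.1 p.2)
  (fun f => Fps (fun i => Fps (fun j => f (i, j)))) (fun p => p.1 + p.2)%N _ _ Phi Q 0.
- by move=> f [].
- move=> v w h; apply/fpsP => i; apply/fpsP => j; exact: (h (i, j)).
- split=> [i j|n m]; first by rewrite /coef2 !fcoef0.
  by rewrite (semi0 (S n m)) ltW.
- move=> W [W1 We]; split.
    have oM v : vanishing 1 (v * W) by exact: (vanishingM (@vanishing0 v) W1).
    rewrite -[1%N]add0n; apply: (vanishingM (@vanishing0 _)).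
    apply: vanishingD; last by rewrite exprSr; exact: oM.
    apply: vanishingD; last by rewrite expr2 mulrA; exact: oM.
    by apply: vanishingD; [exact: vanishing1P|exact: oM].
  move=> n m; have h1 : dnorm r r n m (cst2 (- ga^-1)) <= (nc ga)^-1.
    by apply: le_trans (dnorm_cst2 _ _ _ (ltW r0) (ltW r0)) _; rewrite ncN ncV.
  have h2 := le_trans (dnorm_vanishing1 n m r0 rt dom0 (vanishing1P _ c00)) hr1.
  have h3 := le_trans (dnorm_vanishing1 n m r0 rt dom1 (vanishing1P _ d10)) hr1.
  have h4 := dom_le (ltW r0) rt (ltW r0) rt dom2 n m.
  have h5 := We n m.
  apply: le_trans (semiM_le (S n m) h1 (semiD_le (S n m) (semiD_le (S n m) (semiD_le (S n m) h2
    (semiM_le (S n m) h3 h5)) (semiM_le (S n m) h4 (semiX_le (S n m) 2 h5))) (semiX_le (S n m) 3 h5))) _.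
  rewrite mulrC ler_pdivrMr //.
  have k1 : nc ga * e / 4 * e <= nc ga * e / 4 by rewrite ler_piMr // ltW.
  have k2 : A * e ^+ 2 + e ^+ 3 <= (A + 1) * e * e.
    rewrite (_ : (A + 1) * e * e = A * e ^+ 2 + e ^+ 2); last by ring.
    by rewrite lerD2l exprS ler_piMl // exprn_ge0 // ltW.
  have k3 : (A + 1) * e * e <= nc ga / 4 * e by rewrite ler_wpM2r // ltW.
  have k4 : 0 < nc ga * e by rewrite mulr_gt0.
  have k5 : nc ga / 4 * e = nc ga * e / 4 by rewrite mulrAC.
  lra.
- move=> n V W [V1 _] [W1 _] VW.
  have d : vanishing n (V - W).
    by move=> i j ij; rewrite coef2D coef2N (VW (i, j) ij) subrr.
  suff h : vanishing n.+1 (Phi V - Phi W).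
    move=> [i j] ij /=; apply/eqP; rewrite -subr_eq0 -coef2N -coef2D; apply/eqP.
    exact: h.
  (* [Phi V - Phi W] is a multiple of [V - W] whose cofactor vanishes at the origin, so the order
     rises by one. *)
  have E (K : comNzRingType) (g x0 x1 x2 v w : K) :
    g * (x0 + x1 * v + x2 * v ^+ 2 + v ^+ 3) - g * (x0 + x1 * w + x2 * w ^+ 2 + w ^+ 3) =
    g * ((v - w) * (x1 + (x2 * v + x2 * w + (v * v + v * w + w * w)))) by ring.
  rewrite /Phi E -[n.+1]add0n; apply: (vanishingM (@vanishing0 _)); rewrite -addn1.
  apply: (vanishingM d); apply: vanishingD; first exact: vanishing1P.
  have oM v : vanishing 1 (v * W) by exact: (vanishingM (@vanishing0 v) W1).
  have oM' v : vanishing 1 (v * V) by exact: (vanishingM (@vanishing0 v) V1).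
  by apply: vanishingD; apply: vanishingD => //; apply: vanishingD.
- move=> V h; split.
    by move=> i j ij; have [W [W1 _] VW] := h 1%N; rewrite (VW (i, j)) //; exact: W1.
  (* The truncation to n rows and m columns only involves total degrees below n + m. *)
  move=> n m; have [W [_ We] VW] := h (n + m)%N; apply: le_trans (We n m).
  rewrite !dnormE; apply: ler_sum => i _; apply: ler_sum => j _.
  have ij : (i + j < n + m)%N by exact: leq_add (ltn_ord i) (ltnW (ltn_ord j)).
  have E : coef2 V i j = coef2 W i j := VW (i : nat, j : nat) ij.
  by rewrite E.
move=> W [W1 We] PhiW; exists (Germ (dom_convergent r0 We)); split; first exact: W1.
apply: val_inj; change (germ_val c0 + germ_val c1 * W + germ_val c2 * W ^+ 2 + W ^+ 3 = 0).
have E (K : comNzRingType) (x0 x1 x2 v g g' : K) : g * g' = 1 ->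
    - g' * (x0 + (x1 - g) * v + x2 * v ^+ 2 + v ^+ 3) = v ->
    x0 + x1 * v + x2 * v ^+ 2 + v ^+ 3 = 0.
  move=> gg h; transitivity (g * (v + g' * (x0 + (x1 - g) * v + x2 * v ^+ 2 + v ^+ 3))
    - (g * g' - 1) * (x0 + (x1 - g) * v + x2 * v ^+ 2 + v ^+ 3)); first by ring.
  by rewrite gg subrr mul0r subr0 -{1}h mulNr addNr mulr0.
apply: (E _ _ _ _ _ (cst2 ga) (cst2 ga^-1)).
  by rewrite -cst2M mulfV // cst2_1.
rewrite -[RHS]PhiW /Phi; congr (_ * _).
by apply/fpsP => -[|i]; apply/fpsP => -[|j]; rewrite /= ?oppr0.
Qed.

End Hensel.

(** * Fractions and cubic forms *)

Section Fractions.

Lemma fractionP (A : idomainType) (q : {fraction A}) :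
  exists n d : A, d != 0 /\ q = FracField.tofrac n / FracField.tofrac d.
Proof.
elim/quotW: q => x; exists (frac x).1, (frac x).2; have dx := denom_ratioP x.
split=> //; apply: (canRL (mulfK _)); first by rewrite tofrac_eq0.
unlock FracField.tofrac; rewrite -[LHS]FracField.pi_mul.
apply/eqmodP; rewrite /= FracField.equivfE /FracField.mulf !numden_Ratio ?oner_eq0 ?mulr1 //.
by rewrite mulrC.
Qed.

Lemma common_denominator (A : idomainType) (q : nat -> {fraction A}) n :
  exists (b : A) (a : nat -> A), b != 0 /\
    forall k, (k < n)%N -> q k = FracField.tofrac (a k) / FracField.tofrac b.
Proof.
elim: n => [|n [b [a [b0 IH]]]]; first by exists 1, (fun=> 0); rewrite oner_neq0.
have [c [d [d0 E]]] := fractionP (q n).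
exists (b * d), (fun k => if (k < n)%N then a k * d else c * b).
split=> [|k]; first exact: mulf_neq0.
have tb : FracField.tofrac b != 0 by rewrite tofrac_eq0.
have td : FracField.tofrac d != 0 by rewrite tofrac_eq0.
rewrite ltnS leq_eqVlt => /predU1P[->|kn].
  by rewrite ltnn E !rmorphM /=; apply/eqP; rewrite eqr_div ?mulf_neq0 //; apply/eqP; ring.
by rewrite kn (IH _ kn) !rmorphM /=; apply/eqP; rewrite eqr_div ?mulf_neq0 //; apply/eqP; ring.
Qed.

Lemma cubic_formP (R : realType) (f : {poly (meromorphic R)}) :
  cubic_form f <-> (size f <= 4)%N.
Proof.
split=> [[A [B [C [D ->]]]]|f4].
  have sX n : (size ('X^n : {poly meromorphic R}) <= n.+1)%N by rewrite size_polyXn.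
  apply: leq_trans (size_polyD _ _) _; rewrite geq_max; apply/andP; split; last first.
    exact: leq_trans (size_scale_leq _ _) (sX 3%N).
  apply: leq_trans (size_polyD _ _) _; rewrite geq_max; apply/andP; split; last first.
    by apply: leq_trans (size_scale_leq _ _) _; rewrite (leq_trans (sX 2%N)).
  apply: leq_trans (size_polyD _ _) _; rewrite geq_max; apply/andP; split; last first.
    by apply: leq_trans (size_scale_leq _ _) _; rewrite size_polyX.
  by apply: leq_trans (size_polyC_leq1 _) _.
exists f`_0, f`_1, f`_2, f`_3; apply/polyP => i.
rewrite !coefD !coefZ coefC coefX !coefXn.
case: i => [|[|[|[|i]]]] /=; rewrite ?mulr0 ?mulr1 ?addr0 ?add0r //.
by rewrite nth_default // (leq_trans f4).
Qed.

Lemma prod_three_XsubC (K : nzRingType) (a b c : K) :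
  \prod_(z <- [:: a; b; c]) ('X - z%:P) = ('X - a%:P) * ('X - b%:P) * ('X - c%:P).
Proof. by rewrite !big_cons big_nil mulr1 mulrA. Qed.

Lemma size_three_XsubC (K : fieldType) (a b c : K) :
  size (('X - a%:P) * ('X - b%:P) * ('X - c%:P)) = 4%N.
Proof.
by rewrite -prod_three_XsubC size_prod_XsubC.
Qed.

Lemma factored_cubic (R : realType) (f : {poly (meromorphic R)}) :
  factored_form f -> cubic_form f.
Proof.
move=> [D [w1 [w2 [w3 ->]]]]; apply/cubic_formP.
apply: leq_trans (size_scale_leq _ _) _.
by rewrite size_three_XsubC.
Qed.

(** Divided derivatives keep the expansion inside the ring; it brings the search for a root near g
    into the shape of [cubic_small_root]. *)
Lemma cubic_taylor (K : comNzRingType) (F : {poly K}) (g W : K) :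
  F \is monic -> size F = 4%N ->
  F.[g + W] = F.[g] + F^`().[g] * W + F^`N(2).[g] * W ^+ 2 + W ^+ 3.
Proof.
move=> Fm F4; have F3 : F^`N(3) = 1.
  apply/polyP => i; rewrite coef_nderivn coef1; case: i => [|i].
    by rewrite addn0 binn mulr1n /= -[RHS](monicP Fm) lead_coefE F4.
  by rewrite nth_default ?mul0rn // F4.
rewrite (nderiv_taylor _ (mulrC g W)) F4 !big_ord_recl big_ord0 /bump /=.
by rewrite nderivn0 nderivn1 F3 hornerC !expr0 !mulr1 mul1r addr0 expr1 !addrA.
Qed.

(** Three distinct roots split a monic cubic over a field, so the roots are moved to the field of
    fractions, into which the ring embeds. *)
Lemma monic_cubic_split (A : idomainType) (F : {poly A}) (w1 w2 w3 : A) :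
  F \is monic -> size F = 4%N -> root F w1 -> root F w2 -> root F w3 ->
  w1 != w2 -> w1 != w3 -> w2 != w3 ->
  map_poly (@FracField.tofrac A) F = ('X - (FracField.tofrac w1)%:P)
    * ('X - (FracField.tofrac w2)%:P) * ('X - (FracField.tofrac w3)%:P).
Proof.
move=> Fm sF r1 r2 r3 n12 n13 n23.
have inj : injective (@FracField.tofrac A).
  by move=> x y /eqP; rewrite tofrac_eq => /eqP.
have rt w : root F w -> root (map_poly (@FracField.tofrac A) F) (FracField.tofrac w).
  by move=> /rootP Fw; rewrite /root horner_map /= Fw rmorph0.
have Mm : map_poly (@FracField.tofrac A) F \is monic by exact: monic_map.
have := @all_roots_prod_XsubC _ (map_poly (@FracField.tofrac A) F)
  [:: FracField.tofrac w1; FracField.tofrac w2; FracField.tofrac w3].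
rewrite (size_map_inj_poly inj (rmorph0 _)) sF uniq_rootsE /= !inE !rt //.
rewrite !tofrac_eq negb_or n12 n13 n23 (monicP Mm) scale1r => /(_ erefl isT isT) ->.
exact: prod_three_XsubC.
Qed.

(** * Lifting the roots of the reduced cubic *)

Section SimpleSlopes.
Variable R : realType.
Local Notation C := R[i].
Local Notation coef00 := (@germ00 R).

(** Hensel's lemma started at the constant germ r: there F has no constant term and its derivative
    has a nonzero one. *)
Lemma cubic_root_lift (F : {poly (germ R)}) (r : C) : F \is monic -> size F = 4%N ->
  root (map_poly coef00 F) r -> (map_poly coef00 F)^`().[r] != 0 ->
  exists w : germ R, coef00 w = r /\ root F w.
Proof.
move=> Fm F4 Fr F'r; pose g : germ R := germC r.
have gr : coef00 g = r by exact: coef2_cst2.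
have h0 : coef00 F.[g] = 0 by rewrite -horner_map /= gr; apply/eqP.
have h1 : coef00 F^`().[g] != 0 by rewrite -horner_map /= gr -deriv_map.
have [W [W0 E]] := cubic_small_root (F^`N(2)).[g] h0 h1.
exists (g + W); split; first by rewrite rmorphD /= gr W0 addr0.
by rewrite /root cubic_taylor // E.
Qed.

(** C is algebraically closed, so separability gives three distinct roots at the origin; their lifts
    are distinct because their values at the origin are. *)
Lemma simple_slopes_factored (f : {poly (meromorphic R)}) :
  cubic_form f -> simple_slopes f -> factored_form f.
Proof.
move=> /cubic_formP f4 [f3 [F [Fm fF sepF]]].
have {}f4 : size f = 4%N.
  by apply/eqP; rewrite eqn_leq f4 ltnNge; apply: contra f3 => f3; rewrite nth_default.
have inj : injective (@FracField.tofrac (germ R)).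
  by move=> x y /eqP; rewrite tofrac_eq => /eqP.
have sF : size F = 4%N.
  by rewrite -(size_map_inj_poly inj (rmorph0 _)) -(size_scale _ f3) -fF.
change (is_true (separable_poly (map_poly coef00 F))) in sepF.
set F0 := map_poly coef00 F in sepF.
have F0m : F0 \is monic by exact: monic_map.
have sF0 : size F0 = 4%N.
  by rewrite size_map_poly_id0 // (monicP Fm) rmorph1 oner_neq0.
have [rs] := closed_field_poly_normal F0; rewrite (monicP F0m) scale1r => F0E.
have urs : uniq rs by rewrite -separable_prod_XsubC -F0E.
have srs : size rs = 3%N by move: sF0; rewrite F0E size_prod_XsubC => -[].
have lift r : r \in rs -> exists w : germ R, coef00 w = r /\ root F w.
  move=> rrs; have rF : root F0 r by rewrite F0E root_prod_XsubC.
  apply: cubic_root_lift => //; apply: coprimep_root rF.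
  by move: sepF; rewrite unlock.
case: rs srs F0E urs lift => [|r1 [|r2 [|r3 []]]] // _ _.
rewrite /= !inE !negb_or andbT => /andP[/andP[n12 n13] n23] lift.
have [w1 [e1 Fw1]] := lift r1 (mem_head _ _).
have [w2 [e2 Fw2]] : exists w : germ R, coef00 w = r2 /\ root F w.
  by apply: lift; rewrite !inE eqxx orbT.
have [w3 [e3 Fw3]] : exists w : germ R, coef00 w = r3 /\ root F w.
  by apply: lift; rewrite !inE eqxx !orbT.
exists f`_3, w1, w2, w3; rewrite {1}fF; congr (_ *: _).
have ne (w w' : germ R) : coef00 w != coef00 w' -> w != w' by apply: contraNneq => ->.
by apply: monic_cubic_split => //; apply: ne; rewrite ?e1 ?e2 ?e3.
Qed.

End SimpleSlopes.
End Fractions.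

(** * Conics and contact *)

Lemma deg2_polyE (K : comNzRingType) (g : {poly {poly K}}) :
  (forall i j, (2 < i + j)%N -> g`_i`_j = 0) ->
  g = ((g`_0`_0)%:P + (g`_0`_1)%:P * 'X + (g`_0`_2)%:P * 'X ^+ 2)%:P
    + ((g`_1`_0)%:P + (g`_1`_1)%:P * 'X)%:P * 'X + ((g`_2`_0)%:P)%:P * 'X ^+ 2.
Proof.
move=> g2; apply/polyP => i; apply/polyP => j.
rewrite !coefD !coefCM coefC coefX coefXn.
pose simp := (mulr0, mulr1, addr0, add0r, coef0).
case: i => [|[|[|i]]] /=; rewrite ?simp.
- rewrite !coefD !coefCM coefC coefX coefXn.
  by case: j => [|[|[|j]]] /=; rewrite ?simp // g2.
- rewrite !coefD !coefCM !coefC coefX.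
  by case: j => [|[|j]] /=; rewrite ?simp // g2.
- by rewrite coef1; case: j => [|j] /=; rewrite ?mulr1 ?mulr0 // g2.
- by rewrite g2.
Qed.

Lemma deg2_eval (K : comNzRingType) (g : {poly {poly K}}) (x v : K) :
  (forall i j, (2 < i + j)%N -> g`_i`_j = 0) ->
  [/\ g.[v%:P].[x] = g`_0`_0 + g`_0`_1 * x + g`_0`_2 * x ^+ 2
       + (g`_1`_0 + g`_1`_1 * x) * v + g`_2`_0 * v ^+ 2,
      (g.[v%:P]^`()).[x] = g`_0`_1 + 2 * g`_0`_2 * x + g`_1`_1 * v
    & (g^`()).[v%:P].[x] = g`_1`_0 + g`_1`_1 * x + 2 * g`_2`_0 * v].
Proof.
move=> g2; move: (deg2_polyE g2); set a := g`_0`_0; set b := g`_0`_1; set c := g`_0`_2.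
set d := g`_1`_0; set e := g`_1`_1; set k := g`_2`_0 => gE; rewrite gE.
split; first by rewrite !hornerE.
  rewrite !hornerE !(derivD, derivM, derivC, derivX, derivXn, mul0r, mulr0, add0r, addr0) /=.
  by rewrite !hornerE /=; ring.
rewrite !derivD !derivM !derivC !derivX !mul0r !add0r !mulr1 /=.
by rewrite !hornerE /=; ring.
Qed.

Lemma coef_Poly3 (K : nzRingType) (a b c : K) :
  ((Poly [:: a; b; c])`_0 = a) * ((Poly [:: a; b; c])`_1 = b) *
  ((Poly [:: a; b; c])`_2 = c) * (forall i, (Poly [:: a; b; c])`_i.+3 = 0).
Proof. by rewrite !coef_Poly; do !split=> //; move=> i; rewrite coef_Poly /= nth_nil. Qed.

Section Conics.
Variable R : realType.
Local Notation C := R[i].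
Implicit Types (g : {poly {poly C}}) (P : C * C) (u : C -> C).

(** These three are the partial derivatives of g at P and its second differential on the vector (1,
    p), for g of degree at most two. The first index of a coefficient is the exponent of u, the
    second that of x. *)
Definition conic_dx g P : C := g`_0`_1 + 2 * g`_0`_2 * P.1 + g`_1`_1 * P.2.
Definition conic_du g P : C := g`_1`_0 + g`_1`_1 * P.1 + 2 * g`_2`_0 * P.2.
Definition conic_d2 g (p : C) : C := 2 * g`_0`_2 + 2 * g`_1`_1 * p + 2 * g`_2`_0 * p ^+ 2.

Lemma eval_conic g x v : degree_le2 g ->
  eval_xu g (x, v) = g`_0`_0 + g`_0`_1 * x + g`_0`_2 * x ^+ 2
    + (g`_1`_0 + g`_1`_1 * x) * v + g`_2`_0 * v ^+ 2.
Proof. by move=> g2; have [] := deg2_eval x v g2. Qed.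

Lemma smooth_conic g P : degree_le2 g -> smooth_at g P <-> conic_dx g P != 0 \/ conic_du g P != 0.
Proof.
by move=> g2; rewrite /smooth_at /eval_xu; have [_ -> ->] := deg2_eval P.1 P.2 g2.
Qed.

Lemma contact2_conic g P u : degree_le2 g -> analytic_at u P.1 -> u P.1 = P.2 ->
  contact2 g P u <->
  [/\ eval_xu g P = 0, conic_dx g P + conic_du g P * derive1 u P.1 = 0
    & conic_d2 g (derive1 u P.1) + conic_du g P * derive1n 2 u P.1 = 0].
Proof.
move=> g2 ua uP; have [du1 du2] := analytic_twice_derivable ua.
set h := fun x => eval_xu g (x, u x).
pose h1 x := conic_dx g (x, u x) + conic_du g (x, u x) * derive1 u x.
have idd (x : C) : is_derive x 1 (fun y : C => y) 1 by exact: is_derive_id.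
have cst (c x : C) : is_derive x 1 (fun _ : C => c) 0 by exact: is_derive_cst.
have hh1 (x : C) : is_derive x 1 u (derive1 u x) -> is_derive x 1 h (h1 x).
  move=> ux.
  have -> : h = fun y => g`_0`_0 + g`_0`_1 * y + g`_0`_2 * (y * y)
    + (g`_1`_0 + g`_1`_1 * y) * u y + g`_2`_0 * (u y * u y).
    by apply/funext => y; rewrite /h eval_conic.
  have e1 := is_derive_mul (idd x) (idd x).
  have e2 := is_derive_mul ux ux.
  have e3 := is_derive_mul (is_derive_add (cst g`_1`_0 x) (is_derive_scale g`_1`_1 (idd x))) ux.
  have e4 := is_derive_add (is_derive_add (is_derive_add (is_derive_add (cst g`_0`_0 x)
    (is_derive_scale g`_0`_1 (idd x))) (is_derive_scale g`_0`_2 e1)) e3) (is_derive_scale g`_2`_0 e2).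
  by apply: is_derive_eq e4 _; rewrite /h1 /conic_dx /conic_du /=; ring.
have uP' := nbhs_singleton du1.
have hP : derive1 h P.1 = h1 P.1 by exact: is_derive1E (hh1 _ uP').
(* The first derivative has to be known near P.1 and not only at it, because it is differentiated
   again. *)
have near_h1 : \forall x \near P.1, h1 x = derive1 h x.
  by apply: filterS du1 => x ux; symmetry; exact: is_derive1E (hh1 x ux).
have hh2 : is_derive P.1 1 h1 (conic_d2 g (derive1 u P.1) + conic_du g P * derive1n 2 u P.1).
  have f1 := is_derive_add (is_derive_add (cst g`_0`_1 P.1) (is_derive_scale (2 * g`_0`_2) (idd P.1)))
    (is_derive_scale g`_1`_1 uP').
  have f2 := is_derive_add (is_derive_add (cst g`_1`_0 P.1) (is_derive_scale g`_1`_1 (idd P.1)))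
    (is_derive_scale (2 * g`_2`_0) uP').
  have f3 := is_derive_add f1 (is_derive_mul f2 du2).
  have -> : h1 = fun y => (g`_0`_1 + 2 * g`_0`_2 * y + g`_1`_1 * u y)
    + (g`_1`_0 + g`_1`_1 * y + 2 * g`_2`_0 * u y) * derive1 u y by [].
  by apply: is_derive_eq f3 _; rewrite uP /conic_d2 /conic_du; ring.
have hP2 : derive1n 2 h P.1 = conic_d2 g (derive1 u P.1) + conic_du g P * derive1n 2 u P.1.
  exact: is_derive1E (near_eq_is_derive near_h1 hh2).
have PE : (P.1, u P.1) = P by rewrite uP; case: (P).
by rewrite /contact2 -/h hP hP2 /h1 /h PE.
Qed.

Section Member.
Variables (g1 g2 : {poly {poly C}}) (l m : C).

Lemma coef_member i j : (member g1 g2 l m)`_i`_j = l * g1`_i`_j + m * g2`_i`_j.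
Proof. by rewrite coefD !coefZ coefD !coefCM. Qed.

Lemma member_degree_le2 : degree_le2 g1 -> degree_le2 g2 -> degree_le2 (member g1 g2 l m).
Proof. by move=> h1 h2 i j ij; rewrite coef_member h1 // h2 // !mulr0 addr0. Qed.

Lemma dx_member P : conic_dx (member g1 g2 l m) P = l * conic_dx g1 P + m * conic_dx g2 P.
Proof. by rewrite /conic_dx !coef_member; ring. Qed.

Lemma du_member P : conic_du (member g1 g2 l m) P = l * conic_du g1 P + m * conic_du g2 P.
Proof. by rewrite /conic_du !coef_member; ring. Qed.

Lemma d2_member p : conic_d2 (member g1 g2 l m) p = l * conic_d2 g1 p + m * conic_d2 g2 p.
Proof. by rewrite /conic_d2 !coef_member; ring. Qed.

Lemma eval_member P : eval_xu (member g1 g2 l m) P = l * eval_xu g1 P + m * eval_xu g2 P.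
Proof. by rewrite /eval_xu !hornerE. Qed.

End Member.

Section CenteredConic.
Variables (P : C * C) (a b c d e : C).

(** The expansion of a X + b U + c X^2 + d X U + e U^2 with X = x - xP and U = u - uP. *)
Definition centered_conic : {poly {poly C}} :=
  Poly [:: Poly [:: - a * P.1 - b * P.2 + c * P.1 ^+ 2 + d * P.1 * P.2 + e * P.2 ^+ 2;
                    a - 2 * c * P.1 - d * P.2; c];
           Poly [:: b - d * P.1 - 2 * e * P.2; d; 0]; Poly [:: e; 0; 0]].

Lemma centered_degree_le2 : degree_le2 centered_conic.
Proof.
by case=> [|[|[|i]]] [|[|[|j]]] //= _; rewrite /centered_conic !coef_Poly3 ?coef0.
Qed.

Lemma centered_coefs : [/\ conic_dx centered_conic P = a, conic_du centered_conic P = b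
  & forall p, conic_d2 centered_conic p = 2 * (c + d * p + e * p ^+ 2)].
Proof.
by rewrite /conic_dx /conic_du /conic_d2 /centered_conic !coef_Poly3; split=> [||p]; ring.
Qed.

Lemma eval_centered : eval_xu centered_conic P = 0.
Proof.
rewrite (surjective_pairing P) eval_conic; last exact: centered_degree_le2.
by rewrite /centered_conic !coef_Poly3; ring.
Qed.

End CenteredConic.

(** In the coordinates X, U centred at P the generators are X + (B X^2 + D X U + E U^2) / 2 and U -
    A X^2 / 2. The member with l = -p, m = 1 has slope p, and on the line U = p X its quadratic part
    is - (A + B p + D p^2 + E p^3) X^2 / 2. *)
Lemma pencil_of_cubic P (A B D E : C) : exists g1 g2,
  [/\ is_pencil g1 g2, eval_xu g1 P = 0, eval_xu g2 P = 0
    & forall u, analytic_at u P.1 -> u P.1 = P.2 ->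
        derive1n 2 u P.1 = A + B * derive1 u P.1 + D * derive1 u P.1 ^+ 2 + E * derive1 u P.1 ^+ 3 ->
        exists l m, [/\ (l, m) != (0, 0), smooth_at (member g1 g2 l m) P
          & contact2 (member g1 g2 l m) P u]].
Proof.
pose g1 := centered_conic P 1 0 (B / 2) (D / 2) (E / 2).
pose g2 := centered_conic P 0 1 (- A / 2) 0 0.
have [x1 u1 q1] : [/\ conic_dx g1 P = 1, conic_du g1 P = 0
  & forall p, conic_d2 g1 p = 2 * (B / 2 + D / 2 * p + E / 2 * p ^+ 2)] by exact: centered_coefs.
have [x2 u2 q2] : [/\ conic_dx g2 P = 0, conic_du g2 P = 1
  & forall p, conic_d2 g2 p = 2 * (- A / 2 + 0 * p + 0 * p ^+ 2)] by exact: centered_coefs.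
have dg1 : degree_le2 g1 by exact: centered_degree_le2.
have dg2 : degree_le2 g2 by exact: centered_degree_le2.
exists g1, g2; split; [|exact: eval_centered|exact: eval_centered|].
  split=> // l m lm0.
  have := dx_member g1 g2 l m P; have := du_member g1 g2 l m P.
  rewrite lm0 x1 x2 u1 u2 /conic_dx /conic_du !coef0 !(mulr0, mulr1, add0r, addr0, mul0r).
  by move=> <- <-.
move=> u ua uP u2E; exists (- derive1 u P.1), 1.
have dm := member_degree_le2 (- derive1 u P.1) 1 dg1 dg2.
split.
- by apply/eqP => -[_ /eqP]; rewrite oner_eq0.
- apply/(smooth_conic _ dm); right.
  by rewrite du_member u1 u2 mulr0 add0r mulr1 oner_neq0.
apply/(contact2_conic dm ua uP); split.
- by rewrite eval_member !eval_centered !mulr0 addr0.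
- by rewrite dx_member du_member x1 x2 u1 u2; ring.
- by rewrite d2_member du_member u1 u2 q1 q2 u2E; field.
Qed.

Lemma cubic_of_pencil P g1 g2 (y : C -> C) :
  (forall p, exists l m, [/\ conic_dx (member g1 g2 l m) P != 0 \/ conic_du (member g1 g2 l m) P != 0,
     conic_dx (member g1 g2 l m) P + conic_du (member g1 g2 l m) P * p = 0
     & conic_d2 (member g1 g2 l m) p + conic_du (member g1 g2 l m) P * y p = 0]) ->
  exists T : {poly C}, (size T <= 4)%N /\ forall p, y p = T.[p].
Proof.
move=> h; pose a1 := conic_dx g1 P; pose b1 := conic_du g1 P.
pose a2 := conic_dx g2 P; pose b2 := conic_du g2 P.
have {}h p : exists l m, [/\ l * b1 + m * b2 != 0,
   l * a1 + m * a2 + (l * b1 + m * b2) * p = 0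
   & l * conic_d2 g1 p + m * conic_d2 g2 p + (l * b1 + m * b2) * y p = 0].
  have [l [m]] := h p; rewrite dx_member du_member d2_member -/a1 -/a2 -/b1 -/b2.
  (* A member that is smooth at P and has the finite slope p there has a nonzero u-derivative. *)
  case=> sm e1 e2; exists l, m; split=> //; apply/eqP => b0.
  by move: e1 sm; rewrite b0 mul0r addr0 => ->; rewrite eqxx => -[].
pose De := a1 * b2 - a2 * b1.
have De0 : De != 0.
  (* Two different slopes suffice: the product of the corresponding u-derivatives, both nonzero, is
     a multiple of the determinant. *)
  have [l [m [b0 e0 _]]] := h 0; have [l' [m' [b0' e1 _]]] := h 1.
  rewrite mulr0 addr0 in e0; rewrite mulr1 in e1.
  have : (l * b1 + m * b2) * (l' * b1 + m' * b2) = (l * m' - m * l') * De.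
    have -> : (l * m' - m * l') * De = (l * a1 + m * a2) * (l' * b1 + m' * b2)
       - (l' * a1 + m' * a2) * (l * b1 + m * b2) by rewrite /De; ring.
    have /eqP -> : l' * a1 + m' * a2 == - (l' * b1 + m' * b2) by rewrite -addr_eq0 e1.
    by rewrite e0; ring.
  by move=> E; apply/eqP => D0; move/eqP: E; rewrite D0 mulr0 mulf_eq0 (negbTE b0) (negbTE b0').
pose s0 := 2 * g1`_0`_2; pose s1 := 2 * g1`_1`_1; pose s2 := 2 * g1`_2`_0.
pose t0 := 2 * g2`_0`_2; pose t1 := 2 * g2`_1`_1; pose t2 := 2 * g2`_2`_0.
(* By Cramer's rule l : m is - (a2 + b2 p) : (a1 + b1 p). Eliminating l and m leaves (a2 + b2 p)
   times the second differential of g1, minus (a1 + b1 p) times that of g2, over De; these are its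
   coefficients in p. *)
exists (Poly [:: (a2 * s0 - a1 * t0) / De; (b2 * s0 + a2 * s1 - b1 * t0 - a1 * t1) / De;
  (b2 * s1 + a2 * s2 - b1 * t1 - a1 * t2) / De; (b2 * s2 - b1 * t2) / De]).
split=> [|p]; first exact: size_Poly.
have [l [m [b0 e1 e2]]] := h p.
set be := l * b1 + m * b2 in b0 e1 e2.
have lE : l = - (be * (a2 + b2 * p)) / De.
  apply: (canRL (mulfK De0)).
  have -> : l * De = b2 * (l * a1 + m * a2 + be * p) - be * (a2 + b2 * p) by rewrite /be /De; ring.
  by rewrite e1 mulr0 sub0r.
have mE : m = be * (a1 + b1 * p) / De.
  apply: (canRL (mulfK De0)).
  have -> : m * De = be * (a1 + b1 * p) - b1 * (l * a1 + m * a2 + be * p) by rewrite /be /De; ring.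
  by rewrite e1 mulr0 subr0.
have : be * y p = be * (((a2 + b2 * p) * conic_d2 g1 p - (a1 + b1 * p) * conic_d2 g2 p) / De).
  have -> : be * y p = - (l * conic_d2 g1 p + m * conic_d2 g2 p).
    by apply/eqP; rewrite -addr_eq0 addrC e2.
  rewrite lE mE; clearbody be; field; exact: De0.
move=> /(mulfI b0) ->; rewrite horner_Poly /= /conic_d2 -/s0 -/s1 -/s2 -/t0 -/t1 -/t2.
clearbody De; field; exact: De0.
Qed.

End Conics.

(** * Integral curves and the theorem *)

Section Equations.
Variable R : realType.
Local Notation C := R[i].
Local Notation nc := (@Normc.normc R).
Implicit Types (f : {poly (meromorphic R)}).

Lemma common_dom (a : nat -> germ R) n :
  exists t A : R, 0 < t /\ forall k, (k < n)%N -> dom t t A (a k).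
Proof.
elim: n => [|n [t [A [t0 IH]]]]; first by exists 1, 0.
have [s [B [s0 aB]]] := germ_dom (a n).
pose r := Num.min t s; have r0 : 0 < r by rewrite lt_min t0.
have [rt rs] : r <= t /\ r <= s by rewrite !ge_min !lexx orbT.
exists r, (Num.max A B); split=> // k; rewrite ltnS leq_eqVlt => /predU1P[->|kn] i j.
  apply: le_trans (dom_le (ltW r0) rs (ltW r0) rs aB i j) _.
  by rewrite le_max lexx orbT.
apply: le_trans (dom_le (ltW r0) rt (ltW r0) rt (IH k kn) i j) _.
by rewrite le_max lexx.
Qed.

Lemma ev_affine (x0 x : C) : ev (x - x0) (integ x0 1) = x.
Proof.
rewrite /ev (@csum_fin _ 2) => [|[|[|k]] //=]; last by rewrite mul0r mul0r.
by rewrite !big_ord_recr big_ord0 /= add0r expr0 expr1 mulr1 divr1 mul1r addrC subrK.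
Qed.

Lemma integral_curve_exists f (a : nat -> germ R) (b : germ R) (t A : R) (x0 u0 p : C) :
  0 < t ->
  (forall k, (k < size f)%N -> f`_k = FracField.tofrac (a k) / FracField.tofrac b) ->
  (forall k, (k < size f)%N -> dom t t A (a k)) -> dom t t A b ->
  nc x0 < t -> nc u0 < t -> germ_eval b (x0, u0) != 0 ->
  exists u, integral_curve f (x0, u0) u /\ derive1 u x0 = p.
Proof.
move=> t0 fE aA bA xt ut b0.
(* The solution only stays in a closed polydisc, of radius t1; t1 < t puts it strictly inside the
   polydisc of radius t, as evaluation of the coefficients requires. *)
pose t1 := (Num.max (nc x0) (nc u0) + t) / 2.
have [mx mu] : nc x0 <= Num.max (nc x0) (nc u0) /\ nc u0 <= Num.max (nc x0) (nc u0).
  by rewrite !le_max !lexx orbT.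
have mt : Num.max (nc x0) (nc u0) < t by rewrite gt_max xt.
have nx := nc_ge0 x0.
have [t10 t1t xt1 ut1] : [/\ 0 < t1, t1 < t, nc x0 < t1 & nc u0 < t1].
  by rewrite /t1; split; lra.
have d1 (g : germ R) : dom t t A g -> dom t1 t1 A g.
  by apply: dom_le; rewrite ltW.
have [V [r [M /=]]] := ode_formal_solution p t10 (fun j jd => d1 _ (aA j jd)) (d1 _ bA) xt1 ut1 b0.
set U1 := integ p V; set U := integ u0 U1; set X := integ x0 1.
move=> [r0 bX bU [bU1 bV] E].
pose u y := ev (y - x0) U; pose u1 y := ev (y - x0) U1.
have at0 c W : ev (x0 - x0) (integ c W) = c by rewrite subrr ev0.
have nbr (x : C) : nc (x - x0) < r -> \forall y \near x, nc (y - x0) < r.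
  move=> xr; apply/near_ncP; exists (r - nc (x - x0)); first by rewrite subr_gt0.
  move=> y yx; rewrite -(subrK x y) -addrA; apply: le_lt_trans (ncD _ _) _; lra.
have r00 : nc (x0 - x0) < r by rewrite subrr nc0.
have du (x : C) : nc (x - x0) < r -> is_derive x 1 u (u1 x).
  by move=> xr; have := ev_is_derive bU xr; rewrite fderiv_integ.
have du1 (x : C) : nc (x - x0) < r -> is_derive x 1 u1 (ev (x - x0) V).
  by move=> xr; have := ev_is_derive bU1 xr; rewrite fderiv_integ.
have d1u (x : C) : nc (x - x0) < r -> derive1 u x = u1 x.
  by move=> xr; exact: is_derive1E (du x xr).
have d2u (x : C) : nc (x - x0) < r -> derive1n 2 u x = ev (x - x0) V.
  move=> xr; apply: is_derive1E (near_eq_is_derive _ (du1 x xr)).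
  by apply: filterS (nbr x xr) => y yr; symmetry; exact: d1u.
have evsub (g : germ R) (x : C) : dom t1 t1 A g -> nc (x - x0) < r ->
    ev (x - x0) (subst_germ g X U) = germ_eval g (x, u x).
  by move=> gA xr; rewrite (ev_subst_germ r0 t10 gA bX bU (ltW xr)) ev_affine.
have bsub (g : germ R) : dom t1 t1 A g -> forall n, wnorm nc r n (subst_germ g X U) <= 1 * A.
  move=> gA; apply: (wnorm_comb r0 ler01 gA); exact: (wnorm_subst_term (ltW r0) bX bU).
(* By continuity b does not vanish along the curve near x0, so a k / b represents the coefficient
   there as well. *)
have b_near : \forall x \near x0, germ_eval b (x, u x) != 0.
  have db := ev_is_derive (bsub b (d1 _ bA)) r00.
  have nb : ev (x0 - x0) (subst_germ b X U) != 0 by rewrite (evsub _ _ (d1 _ bA) r00) /u at0.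
  apply: filterS2 (is_derive_near_ne0 db nb) (nbr x0 r00) => x + xr.
  by rewrite (evsub _ _ (d1 _ bA) xr).
exists u; split; last by rewrite (d1u _ r00) /u1 at0.
split.
- exists (fcoef U); apply: filterS (nbr x0 r00) => x xr.
  exact: csum_cvg (wnorm_asum (ltW xr) bU).
- exact: at0.
apply: filterS2 b_near (nbr x0 r00) => x bx xr; rewrite (d2u _ xr) (d1u _ xr).
have sr := ltW xr.
have xt' : nc (x, u x).1 < t.
  by apply: le_lt_trans t1t; rewrite /= -(ev_affine x0 x); exact: (ev_le sr bX).
have ut' : nc (x, u x).2 < t by apply: le_lt_trans t1t; exact: (ev_le sr bU).
have inp (g : germ R) : dom t t A g -> in_polydisc g (x, u x).
  by move=> gA; exact: dom_in_polydisc (ltW t0) gA xt' ut'.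
have S n := wnorm_seminorm (nc_seminorm R) n (ltW r0).
have EV : ev (x - x0) V * germ_eval b (x, u x) =
    \sum_(k < size f) germ_eval (a k) (x, u x) * u1 x ^+ k.
  rewrite -(evsub _ _ (d1 _ bA) xr) -(evM sr bV (bsub _ (d1 _ bA))) E.
  have tk (k : 'I_(size f)) n : wnorm nc r n (subst_germ (a k) X U * U1 ^+ k) <= 1 * A * M ^+ k.
    by apply: (semiM_le (S n) (bsub _ (d1 _ (aA k (ltn_ord k))) n) (semiX_le (S n) k (bU1 n))).
  have [_ E2] := csum_sum_asum (index_enum 'I_(size f)) (fun k => wnorm_asum sr (tk k)).
  transitivity (\sum_(k < size f) ev (x - x0) (subst_germ (a k) X U * U1 ^+ k)).
    rewrite -E2 /ev; apply: eq_csum => n; rewrite fcoef_sum mulr_suml //.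
  apply: eq_bigr => k _; have ak := d1 _ (aA k (ltn_ord k)).
  by rewrite (evM sr (bsub _ ak) (fun n => semiX_le (S n) k (bU1 n))) (evsub _ _ ak xr) (evX sr k bU1).
rewrite /rhs -[LHS](mulfK bx) EV mulr_suml; apply: eq_bigr => k _.
have kf := ltn_ord k.
by rewrite (fE k kf) (frac_eval_tofrac (inp _ (aA _ kf)) (inp _ bA) bx) mulrAC.
Qed.

(** * Cubic forms and contact pencils *)

Lemma cubic_has_contact_pencils f : cubic_form f -> has_contact_pencils f.
Proof.
move=> /cubic_formP f4; apply/near_nc2P; exists 1 => // x0 u0 _ _ _.
set P := (x0, u0).
(* [rhs] has [size f] summands; padding by zeros brings it to the four of a cubic. *)
pose e k := if (k < size f)%N then frac_eval f`_k P else 0.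
have [g1 [g2 [pen e1 e2 H]]] := pencil_of_cubic P (e 0%N) (e 1%N) (e 2%N) (e 3%N).
exists g1, g2; split=> // u [ua uP un]; apply: H => //.
have := nbhs_singleton un; rewrite uP => ->.
rewrite /rhs (big_ord_widen 4 (fun k => frac_eval f`_k P * derive1 u P.1 ^+ k) f4).
rewrite big_mkcond /=.
transitivity (\sum_(k < 4) e k * derive1 u P.1 ^+ k).
  by apply: eq_bigr => k _; rewrite /e; case: ifP => // _; rewrite mul0r.
by rewrite !big_ord_recr big_ord0 /= add0r expr0 expr1 mulr1.
Qed.

(** At a point where neither the leading numerator nor the common denominator vanishes, the
    right-hand side has the same degree in p as f has in u', so the bound found at that point bounds
    f. *)
Lemma contact_pencils_cubic f : has_contact_pencils f -> cubic_form f.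
Proof.
move=> /near_nc2P[e e0 H]; apply/cubic_formP; rewrite leqNgt; apply/negP => f5.
have [b [a [b0 fE]]] := common_denominator (fun k => f`_k) (size f).
pose k := (size f).-1; have kf : (k < size f)%N by rewrite /k prednK // (leq_trans _ f5).
have k4 : (4 <= k)%N by rewrite -ltnS /k prednK // (leq_trans _ f5).
have ak0 : a k != 0.
  apply: contraTneq (f5) => ak; rewrite -leqNgt; have := fE k kf.
  rewrite ak rmorph0 mul0r => /eqP; rewrite -lead_coefE lead_coef_eq0 => /eqP ->.
  by rewrite size_poly0.
(* b sits at index 0 and a j at j.+1, so that one polydisc serves all of them. *)
have [t [A [t0 abA]]] := common_dom (fun i => if i is j.+1 then a j else b) (size f).+1.
have bA : dom t t A b by exact: (abA 0%N).
have aA j : (j < size f)%N -> dom t t A (a j) by exact: (abA j.+1).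
have m0 : 0 < Num.min e t by rewrite lt_min e0.
have [P [xm um ne0]] := germ_eval_neq0 (mulf_neq0 ak0 b0) m0.
case: P => x0 u0 /= in xm um ne0 *.
move: xm um; rewrite !lt_min => /andP[xe xt] /andP[ue ut].
have inp (g : germ R) : dom t t A g -> in_polydisc g (x0, u0).
  by move=> gA; exact: dom_in_polydisc (ltW t0) gA _ _.
rewrite (germ_evalM (inp _ (aA _ kf)) (inp _ bA)) mulf_eq0 negb_or in ne0.
case/andP: ne0 => akP bP.
have fv j : (j < size f)%N -> frac_eval f`_j (x0, u0) = germ_eval (a j) (x0, u0) / germ_eval b (x0, u0).
  by move=> jf; rewrite (fE j jf) (frac_eval_tofrac (inp _ (aA _ jf)) (inp _ bA) bP).
have ns : nonsingular_coefs f (x0, u0).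
  move=> j; have [jf|fj] := ltnP j (size f).
    exists (germ_eval (a j) (x0, u0) / germ_eval b (x0, u0)), (a j), b.
    by split; [exact: fE|split; apply: inp => //; exact: aA|exact: bP|].
  (* [nonsingular_coefs] ranges over all indices, so the zero coefficients beyond the degree also
     need a representative, here 0 / b. *)
  exists (germ_eval 0 (x0, u0) / germ_eval b (x0, u0)), 0, b; split=> //; last first.
    split; last exact: inp.
    by apply: (inp 0) => n m; rewrite (semi0 (dnorm_seminorm _ _ (ltW t0) (ltW t0))) (dom_ge0 bA).
  by rewrite rmorph0 mul0r nth_default.
have [g1 [g2 [[dg1 dg2 _] _ _ G]]] := H x0 u0 xe ue ns.
have [|T [T4 TE]] := @cubic_of_pencil R (x0, u0) g1 g2 (rhs f (x0, u0)).
  move=> p; have [u [ui up]] := integral_curve_exists p t0 fE aA bA xt ut bP.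
  have [l [m [_ sm ct]]] := G u ui; exists l, m; have [ua uP un] := ui.
  have dm := member_degree_le2 l m dg1 dg2.
  have [_ c1 c2] := (contact2_conic dm ua uP).1 ct.
  have u2 := nbhs_singleton un; rewrite /= in uP up u2 c1 c2.
  rewrite u2 uP up in c2; rewrite up in c1.
  by split=> //; exact/(smooth_conic _ dm).
pose q := \poly_(j < size f) frac_eval f`_j (x0, u0).
have qT : q = T.
  (* The two polynomials agree at every slope, while a nonzero polynomial over C has a non-root. *)
  apply/eqP; rewrite -subr_eq0; apply/negPn/negP => /closed_nonrootP[p /negP]; apply.
  by rewrite /root hornerD hornerN -TE horner_poly subrr.
have : q`_k = 0 by rewrite qT nth_default // (leq_trans T4).
rewrite coef_poly kf fv // => /eqP; rewrite mulf_eq0 invr_eq0 (negbTE akP) (negbTE bP) //.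
Qed.

End Equations.

Theorem theorem3p3 (R : realType) (f : {poly (meromorphic R)}) :
  [/\ cubic_form f <-> has_contact_pencils f,
      factored_form f -> has_contact_pencils f
    & has_contact_pencils f -> simple_slopes f -> factored_form f].
Proof.
split.
- by split; [exact: cubic_has_contact_pencils|exact: contact_pencils_cubic].
- by move=> /factored_cubic; exact: cubic_has_contact_pencils.
- by move=> /contact_pencils_cubic; exact: simple_slopes_factored.
Qed.
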